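(* Let $\kappa,\tau,H\in\mathbb{R}$, let $\delta=\delta_\kappa(x,y)=1+\frac{\kappa}{4}(x^2+y^2)$, and let $\Omega\subset\mathcal{M}_\kappa=\{(x,y)\in\mathbb{R}^2:\delta_\kappa(x,y)>0\}$ be a simply connected domain. For $C^2$ functions $f,g:\Omega\to\mathbb{R}$ write $$(\alpha,\beta)=\left(f_x+\tau\frac{y}{\delta},\ f_y-\tau\frac{x}{\delta}\right),\quad \omega=\sqrt{1+\delta^2(\alpha^2+\beta^2)},$$ $$(\tilde\alpha,\tilde\beta)=\left(g_x-H\frac{y}{\delta},\ g_y+H\frac{x}{\delta}\right),\quad \tilde\omega=\sqrt{1-\delta^2(\tilde\alpha^2+\tilde\beta^2)},$$ where $\tilde\omega$ is considered only when the spacelike condition $1-\delta^2(\tilde\alpha^2+\tilde\beta^2)>0$ holds on $\Omega$. (a) There is a one-to-one correspondence (the twin correspondence), up to adding constants to $f$ and to $g$, between solutions $f:\Omega\to\mathbb{R}$ of $$\frac{2H}{\delta^2}=\frac{\partial}{\partial x}\left(\frac{\alpha}{\omega}\right)+\frac{\partial}{\partial y}\left(\frac{\beta}{\omega}\right)$$ and solutions $g:\Omega\to\mathbb{R}$, satisfying the spacelike condition $1-\delta^2(\tilde\alpha^2+\tilde\beta^2)>0$, of $$\frac{2\tau}{\delta^2}=\frac{\partial}{\partial x}\left(\frac{\tilde\alpha}{\tilde\omega}\right)+\frac{\partial}{\partial y}\left(\frac{\tilde\beta}{\tilde\omega}\right).$$ (b) The correspondence in (a) is obtained by solving the twin relation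 $$(\tilde\alpha,\tilde\beta)=\left(-\frac{\beta}{\omega},\ \frac{\alpha}{\omega}\right),\quad\text{or equivalently}\quad (\alpha,\beta)=\left(\frac{\tilde\beta}{\tilde\omega},\ -\frac{\tilde\alpha}{\tilde\omega}\right);$$ that is, $f$ and $g$ correspond to each other exactly when they satisfy the twin relation, and the two forms of the twin relation are equivalent. (c) The twin correspondence is involutive: if $g$ is obtained from a solution $f$ by the first form of the twin relation and $\hat f$ is then obtained from $g$ by the second form, then $\hat f-f$ is constant, i.e. the twin of the twin of the graph $z=f(x,y)$ is that graph up to a vertical translation.
   Context: Functions are of class $C^2$. Geometric meaning of the two equations. Let $\mathbf{V}=\{(x,y,z)\in\mathbb{R}^3:\delta_\kappa(x,y)>0\}$. The Riemannian Bianchi--Cartan--Vranceanu space $\mathbb{E}^3(\kappa,\tau)$ is $\mathbf{V}$ with the metric $\frac{dx^2+dy^2}{\delta_\kappa^2}+\left[\tau\,\frac{y\,dx-x\,dy}{\delta_\kappa}+dz\right]^2$. The first equation is the equation expressing that the graph $z=f(x,y)$ in $\mathbb{E}^3(\kappa,\tau)$ has constant mean curvature $H$ (half the trace of the second fundamental form, with the sign convention fixed by that equation). The second equation, together with the spacelike condition, expresses that the graph $z=g(x,y)$ is spacelike (positive definite induced metric) and has constant mean curvature $\tau$ in the Lorentzian Bianchi--Cartan--Vranceanu space $\mathbb{L}^3(\kappa,H)$, realized on $\mathbf{V}$ with the metric $\frac{dx^2+dy^2}{\delta_\kappa^2}-\left[-H\,\frac{y\,dx-x\,dy}{\delta_\kappa}+dz\right]^2$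 (with the sign convention fixed by the second equation). The graphs $z=f(x,y)$ and $z=g(x,y)$ related by the twin relation are called twin surfaces of each other. *)

(* Defs.v *)
From HB Require Import structures.
From mathcomp Require Import all_boot all_order all_algebra.
From mathcomp Require Import all_classical all_reals all_analysis.
Set Implicit Arguments.
Unset Strict Implicit.
Unset Printing Implicit Defensive.
Import Order.TTheory GRing.Theory Num.Theory.
Import numFieldNormedType.Exports.
Local Open Scope classical_set_scope.
Local Open Scope ring_scope.

Definition dx (R : realType) (f : R * R -> R) (p : R * R) : R :=
  'D_((1, 0) : R * R) f p.
Definition dy (R : realType) (f : R * R -> R) (p : R * R) : R :=
  'D_((0, 1) : R * R) f p.

(* Functions on a plane domain Omega are represented by total functions
   R * R -> R.  Every notion below is meant for open Omega and then depends
   only on the values on Omega: [derivable] and [continuous] are taken at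
   points of Omega. *)

(* All partial derivatives of order at most k exist and are continuous. *)
Fixpoint class_C (R : realType) (k : nat) (Omega : set (R * R))
    (f : R * R -> R) : Prop :=
  (forall p, Omega p -> {for p, continuous f}) /\
  match k with
  | 0%N => True
  | k'.+1 =>
      (forall p, Omega p ->
         derivable f p ((1, 0) : R * R) /\ derivable f p ((0, 1) : R * R)) /\
      class_C k' Omega (dx f) /\ class_C k' Omega (dy f)
  end.

Definition domain (R : realType) (Omega : set (R * R)) : Prop :=
  [/\ Omega !=set0, open Omega & connected Omega].

Definition loop_in (R : realType) (Omega : set (R * R)) (gamma : R -> R * R) :
    Prop :=
  [/\ {within `[0, 1]%classic, continuous gamma},
      gamma @` `[0, 1]%classic `<=` Omega & gamma 0 = gamma 1].

(* Homotopy with fixed endpoints; in F (s, t) the variable s is the time of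
   the deformation and t the parameter along the loop. *)
Definition null_homotopic_in (R : realType) (Omega : set (R * R))
    (gamma : R -> R * R) : Prop :=
  exists F : R * R -> R * R,
    [/\ {within (`[0, 1]%classic `*` `[0, 1]%classic), continuous F},
        F @` (`[0, 1]%classic `*` `[0, 1]%classic) `<=` Omega,
        forall t : R, 0 <= t <= 1 -> F (0, t) = gamma t,
        forall t : R, 0 <= t <= 1 -> F (1, t) = gamma 0 &
        forall s : R, 0 <= s <= 1 -> F (s, 0) = gamma 0 /\ F (s, 1) = gamma 0].

Definition simply_connected_domain (R : realType) (Omega : set (R * R)) :
    Prop :=
  domain Omega /\
  forall gamma, loop_in Omega gamma -> null_homotopic_in Omega gamma.

Section Twins.
Variables (R : realType) (kappa tau H : R).

Definition delta (p : R * R) : R :=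
  1 + kappa / 4 * (p.1 ^+ 2 + p.2 ^+ 2).

Definition Mkappa : set (R * R) := [set p | 0 < delta p].

Definition alpha (f : R * R -> R) (p : R * R) : R :=
  dx f p + tau * (p.2 / delta p).
Definition beta (f : R * R -> R) (p : R * R) : R :=
  dy f p - tau * (p.1 / delta p).
Definition omega (f : R * R -> R) (p : R * R) : R :=
  Num.sqrt (1 + delta p ^+ 2 * (alpha f p ^+ 2 + beta f p ^+ 2)).

Definition talpha (g : R * R -> R) (p : R * R) : R :=
  dx g p - H * (p.2 / delta p).
Definition tbeta (g : R * R -> R) (p : R * R) : R :=
  dy g p + H * (p.1 / delta p).
Definition tomega (g : R * R -> R) (p : R * R) : R :=
  Num.sqrt (1 - delta p ^+ 2 * (talpha g p ^+ 2 + tbeta g p ^+ 2)).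

Definition spacelike (Omega : set (R * R)) (g : R * R -> R) : Prop :=
  forall p, Omega p ->
    0 < 1 - delta p ^+ 2 * (talpha g p ^+ 2 + tbeta g p ^+ 2).

(* Graphs of constant mean curvature H in E^3(kappa, tau). *)
Definition riemannian_solution (Omega : set (R * R)) : set (R * R -> R) :=
  [set f | class_C 2 Omega f /\
     forall p, Omega p ->
       2 * H / delta p ^+ 2 =
       dx (fun q => alpha f q / omega f q) p +
       dy (fun q => beta f q / omega f q) p].

(* Spacelike graphs of constant mean curvature tau in L^3(kappa, H). *)
Definition lorentzian_solution (Omega : set (R * R)) : set (R * R -> R) :=
  [set g | [/\ class_C 2 Omega g, spacelike Omega g &
     forall p, Omega p ->
       2 * tau / delta p ^+ 2 =
       dx (fun q => talpha g q / tomega g q) p +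
       dy (fun q => tbeta g q / tomega g q) p]].

Definition twin_first (Omega : set (R * R)) (f g : R * R -> R) : Prop :=
  forall p, Omega p ->
    (talpha g p, tbeta g p) =
    (- (beta f p / omega f p), alpha f p / omega f p).

(* Only meaningful for spacelike g: otherwise the square root in tomega is
   the junk value 0. *)
Definition twin_second (Omega : set (R * R)) (f g : R * R -> R) : Prop :=
  forall p, Omega p ->
    (alpha f p, beta f p) =
    (tbeta g p / tomega g p, - (talpha g p / tomega g p)).

End Twins.

Definition eq_up_to_constant (R : realType) (Omega : set (R * R))
    (f h : R * R -> R) : Prop :=
  exists c : R, forall p, Omega p -> h p = f p + c.

Definition class_mod_constants (R : realType) (Omega : set (R * R))
    (S : set (R * R -> R)) (f : R * R -> R) : set (R * R -> R) :=
  [set h | S h /\ eq_up_to_constant Omega f h].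

Definition quotient_mod_constants (R : realType) (Omega : set (R * R))
    (S : set (R * R -> R)) : set (set (R * R -> R)) :=
  class_mod_constants Omega S @` S.

(* Main.v *)
Require Import Defs.
From mathcomp Require Import all_boot all_order all_algebra.
From mathcomp Require Import all_classical all_reals all_analysis.
From mathcomp Require Import ring lra.

(** The mean curvature equation of the graph of f is the integrability
    condition of its twin relation.  Indeed the first form of the relation
    prescribes the gradient of g,
    [g_x = - beta / omega + H y / delta], [g_y = alpha / omega - H x / delta],
    and since [(x / delta)_x + (y / delta)_y = 2 / delta ^ 2]
    ([divergence_position_delta]) this field is closed exactly when
    [(alpha / omega)_x + (beta / omega)_y = 2 H / delta ^ 2].  On a simply
    connected domain a closed field of class C^1 is a gradient
    ([poincare_lemma]), so that every solution f has a twin g, unique up to a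
    constant.

    The function g found in this way is automatically a solution.  By algebra
    alone [1 - delta ^ 2 (talpha ^ 2 + tbeta ^ 2) = 1 / omega ^ 2], hence g is
    spacelike, [tomega = 1 / omega], and the relation can be solved back for
    (alpha, beta), which is its second form ([twin_firstP]).  The equation for g
    then says that [alpha_y - beta_x = 2 tau / delta ^ 2], and this holds for
    every f of class C^2 because mixed partial derivatives commute
    ([curl_alpha_beta]).  As talpha and tbeta are alpha and beta with parameter
    - H in place of tau, the passage from g to f is the same argument.

    The Poincare lemma is proved in two steps.  On a square, a closed field
    (P, Q) has the primitive [int_a^x P (t, b) dt + int_b^y Q (x, s) ds]
    ([local_primitive]).  Passing from squares to the domain uses only that two
    local primitives differ by a constant where both are defined
    ([monodromy]): integrate along paths by patching local primitives, and
    compare two paths with the same ends by patching local primitives over the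
    square that carries a null-homotopy of the loop they form. *)

Set Implicit Arguments.
Unset Strict Implicit.
Unset Printing Implicit Defensive.
Import Order.TTheory GRing.Theory Num.Theory.
Import numFieldNormedType.Exports.
Local Open Scope classical_set_scope.
Local Open Scope ring_scope.

(** * Induction over segments and connected sets *)

(** Compactness of a segment, as an induction principle: the supremum of the t
    with [P a t] is attained and cannot be smaller than b.  It serves for
    constancy of locally constant functions, for the gluing of local lifts, and
    for uniform estimates. *)
Lemma interval_ind (R : realType) (P : R -> R -> Prop) (a b : R) : a <= b ->
  (forall x y z, a <= x -> x <= y -> y <= z -> z <= b ->
     P x y -> P y z -> P x z) ->
  (forall t, a <= t <= b -> exists2 e : R, 0 < e &
     forall x y, a <= x -> x <= t -> t <= y -> y <= b ->
       t - e < x -> y < t + e -> P x y) ->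
  P a b.
Proof.
move=> ab Ptrans Ploc.
pose S := [set t | a <= t <= b /\ P a t].
have Sa : S a.
  split; first by rewrite lexx.
  have /Ploc[e e0 He] : a <= a <= b by rewrite lexx.
  by apply: He => //; lra.
have supS : has_sup S.
  by split; [exists a | exists b => t [/andP[]]].
have am : a <= sup S by apply: ub_le_sup => //; case: supS.
have mb : sup S <= b by apply: ge_sup; [exists a|move=> t [/andP[]]].
have /Ploc[e e0 He] : a <= sup S <= b by rewrite am.
have [x Sx xm] := sup_adherent e0 supS.
have xm' : x <= sup S by apply: ub_le_sup => //; case: supS.
case: Sx => /andP[ax xb] Pax.
have Py y : sup S <= y -> y <= b -> y < sup S + e -> P a y.
  move=> my yb ye; apply: (Ptrans a x y) => //; first by lra.
  exact: He.
have [mb'|bm] := ltP (sup S) b; last first.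
  have bE : b = sup S by lra.
  by apply: Py; lra.
pose y := Num.min b (sup S + e / 2).
have yb : y <= b by rewrite /y ge_min lexx.
have ye : y <= sup S + e / 2 by rewrite /y ge_min lexx orbT.
have my : sup S < y by rewrite /y lt_min mb'; lra.
have : S y by split; [apply/andP; split => //; lra | apply: Py; lra].
have : y <= sup S -> False by lra.
move=> + Sy; case; apply: ub_le_sup => //; by case: supS.
Qed.

Lemma locally_constant_itv (R : realType) (D : R -> R) (a b : R) : a <= b ->
  (forall t, a <= t <= b -> exists2 e : R, 0 < e &
     forall x y, a <= x -> x <= t -> t <= y -> y <= b ->
       t - e < x -> y < t + e -> D x = D y) ->
  D a = D b.
Proof.
by move=> ab Dloc; apply: (interval_ind ab _ Dloc) => x y z _ _ _ _ -> ->.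
Qed.

(** The hypothesis makes both S and its complement relatively open in A. *)
Lemma connected_ind (T : topologicalType) (A S : set T) : connected A ->
  (exists2 p, A p & S p) ->
  (forall p, A p -> exists2 U, open_nbhs p U &
     forall q, A q -> U q -> (S q <-> S p)) ->
  A `<=` S.
Proof.
move=> cA [p0 Ap0 Sp0] loc.
have key (Q : set T) :
    (forall p, A p -> exists2 U, open_nbhs p U &
       forall q, A q -> U q -> (Q q <-> Q p)) ->
    exists2 C, open C & A `&` Q = A `&` C.
  move=> locQ; exists (\bigcup_(U in [set U | open U /\ A `&` U `<=` Q]) U).
    by apply: bigcup_open => U [].
  apply/seteqP; split => p [Ap]; last first.
    by move=> [U [oU AU] Up]; split => //; apply: AU.
  move=> Qp; split => //; have [U [oU Up] HU] := locQ p Ap.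
  by exists U => //; split => // q [Aq Uq]; apply/HU.
suff <- : A `&` S = A by move=> p [].
apply: cA.
- by exists p0.
- have [C oC E] := key S loc; by exists C.
- have [|C oC E] := key (~` S).
    move=> p Ap; have [U oU HU] := loc p Ap; exists U => // q Aq Uq.
    by have HH := HU q Aq Uq; split => nS /HH.
  exists (~` C); first exact: open_closedC.
  apply/seteqP; split => p [Ap].
    by move=> Sp; split => // Cp; have : (A `&` C) p by []; rewrite -E => -[].
  move=> nC; split => //; apply: contrapT => nS; apply: nC.
  by have : (A `&` ~` S) p by []; rewrite E => -[].
Qed.

(** * From local to global: lifting along paths and homotopies *)

Lemma ball_coord (R : realType) (p q : R * R) (e : R) :
  ball p e q <-> `|p.1 - q.1| < e /\ `|p.2 - q.2| < e.
Proof. by []. Qed.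

(** Balls of the plane are squares here, hence convex; the estimate is made
    coordinatewise. *)
Lemma segment_in_ball (R : realType) (i p q : R * R) (r l : R) :
  ball i r p -> ball i r q -> 0 <= l <= 1 -> ball i r (p + l *: (q - p)).
Proof.
move=> /ball_coord[p1 p2] /ball_coord[q1 q2] hl.
have key (x a b : R) : `|x - a| < r -> `|x - b| < r -> `|x - (a + l * (b - a))| < r.
  by rewrite !ltr_norml => ? ?; case: (leP a b) => ?; nra.
by apply/ball_coord; split; apply: key.
Qed.

Lemma continuous_min_cst (R : realType) (f : R -> R) (a : R) :
  continuous f -> continuous (fun t => Num.min (f t) a).
Proof.
by move=> cf t; apply: (@continuous_min R R f (fun=> a)); [exact: cf | exact: cvg_cst].
Qed.

Lemma continuous_max_cst (R : realType) (f : R -> R) (a : R) :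
  continuous f -> continuous (fun t => Num.max (f t) a).
Proof.
by move=> cf t; apply: (@continuous_max R R f (fun=> a)); [exact: cf | exact: cvg_cst].
Qed.

Lemma continuous_double (R : realType) : continuous (fun t : R => 2 * t).
Proof. by move=> t; apply: cvgM; [exact: cvg_cst | exact: cvg_id]. Qed.

Section Monodromy.
Variables (R : realType) (Omega : set (R * R)).
Variables (rad : R * R -> R) (h : R * R -> R * R -> R).
Hypothesis rad_gt0 : forall i, Omega i -> 0 < rad i.
Let U (i : R * R) : set (R * R) := ball i (rad i).
Hypothesis coherent : forall i j p q, Omega i -> Omega j ->
  U i p -> U j p -> U i q -> U j q -> h i p - h i q = h j p - h j q.

(** [phi] is the integral along [c] of the field whose primitives are the [h i]:
    on every stretch of time that [c] spends in one ball, [phi] grows as the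
    local primitive does.  Asking this of all stretches, not only of short ones,
    allows an interval of times to be cut anywhere. *)
Definition lifts (c : R -> R * R) (phi : R -> R) (a b : R) :=
  forall i s t, Omega i -> a <= s -> s <= t -> t <= b ->
    (forall u, s <= u <= t -> U i (c u)) ->
    phi t - phi s = h i (c t) - h i (c s).

Lemma lifts_cat c phi a m b :
  lifts c phi a m -> lifts c phi m b -> lifts c phi a b.
Proof.
move=> L1 L2 i s t Oi as_ st tb Hu.
have [tm|mt] := leP t m; first exact: L1.
have [ms|sm] := leP m s; first exact: L2.
have Ls : phi m - phi s = h i (c m) - h i (c s).
  by apply: (L1 i s m) => //; [lra | move=> u /andP[? ?]; apply: Hu; lra].
have Lt : phi t - phi m = h i (c t) - h i (c m).
  by apply: (L2 i m t) => //; [lra | move=> u /andP[? ?]; apply: Hu; lra].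
lra.
Qed.

(** The difference of two lifts of the same path is locally constant. *)
Lemma lifts_unique c phi psi a b : a <= b -> continuous c ->
  (forall t, a <= t <= b -> Omega (c t)) ->
  lifts c phi a b -> lifts c psi a b -> phi b - phi a = psi b - psi a.
Proof.
move=> ab cc cO L1 L2.
suff : phi a - psi a = phi b - psi b by lra.
apply: (locally_constant_itv ab (D := fun t => phi t - psi t)) => t tab.
have Oct : Omega (c t) by exact: cO.
have [e /= e0 He] : \forall u \near t, ball (c t) (rad (c t)) (c u).
  exact: (cc t) (nbhsx_ballx _ _ (rad_gt0 Oct)).
exists e => // x y ax xt ty yb tx yt.
have Hu u : x <= u <= y -> U (c t) (c u).
  by move=> /andP[xu uy]; apply: He; rewrite /ball_ /= ltr_norml; lra.
have xy : x <= y by lra.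
have := L1 _ _ _ Oct ax xy yb Hu; have := L2 _ _ _ Oct ax xy yb Hu; lra.
Qed.

(** The two-parameter analogue of [lifts].  It is tested on subrectangles, which
    a line parallel to an axis cuts into subrectangles with a common point. *)
Definition square_lifts (F : R * R -> R * R) (Phi : R * R -> R) (a b c d : R) :=
  forall i s1 s2 t1 t2, Omega i ->
    a <= s1 -> s1 <= s2 -> s2 <= b -> c <= t1 -> t1 <= t2 -> t2 <= d ->
    (forall s t, s1 <= s <= s2 -> t1 <= t <= t2 -> U i (F (s, t))) ->
    forall s t, s1 <= s <= s2 -> t1 <= t <= t2 ->
      Phi (s, t) - h i (F (s, t)) = Phi (s1, t1) - h i (F (s1, t1)).

(** Continuity of F on the unit square, in the form in which it is used: points
    near (s, t) are mapped to the ball around F (s, t). *)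
Definition square_map (F : R * R -> R * R) :=
  forall s t, 0 <= s <= 1 -> 0 <= t <= 1 -> Omega (F (s, t)) /\
    exists2 e : R, 0 < e & forall s' t', 0 <= s' <= 1 -> 0 <= t' <= 1 ->
      s - e < s' < s + e -> t - e < t' < t + e -> U (F (s, t)) (F (s', t')).

Let transpose (A : Type) (F : R * R -> A) (z : R * R) := F (z.2, z.1).

Lemma square_lifts_transpose F Phi a b c d :
  square_lifts F Phi a b c d ->
  square_lifts (transpose F) (transpose Phi) c d a b.
Proof.
move=> L i s1 s2 t1 t2 Oi cs s12 sd at_ t12 tb HU s t hs ht.
by apply: (L i t1 t2 s1 s2) => // ? ? ? ?; apply: HU.
Qed.

(** On the common edge the difference of the two lifts is locally constant,
    hence constant; adding it to the second lift makes them agree. *)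
Lemma square_lifts_cat F Phi1 Phi2 a b c m d : square_map F ->
  0 <= a -> a <= b -> b <= 1 -> 0 <= c -> c <= m -> m <= d -> d <= 1 ->
  square_lifts F Phi1 a b c m -> square_lifts F Phi2 a b m d ->
  exists Phi, square_lifts F Phi a b c d.
Proof.
move=> Fc a0 ab b1 c0 cm md d1 L1 L2.
pose D s := Phi1 (s, m) - Phi2 (s, m).
have DE s : a <= s <= b -> D a = D s.
  move=> /andP[as_ sb]; apply: locally_constant_itv => // s0 hs0.
  have [] := Fc s0 m _ _; [lra | lra | move=> O0 [e e0 He]].
  exists e => // x y ax xs sy yb ex ey.
  have HU u t : x <= u <= y -> m <= t <= m -> U (F (s0, m)) (F (u, t)).
    by move=> ? ?; apply: He; lra.
  have := @L1 _ x y m m O0 ax _ _ cm (lexx m) (lexx m) HU y m.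
  have := @L2 _ x y m m O0 ax _ _ (lexx m) (lexx m) md HU y m.
  by rewrite /D => E1 E2; have := E1; have := E2; lra.
exists (fun z => if z.2 <= m then Phi1 z else Phi2 z + D a).
have low s t : t <= m -> (if t <= m then Phi1 (s, t) else Phi2 (s, t) + D a) =
   Phi1 (s, t) by move=> ->.
have up s t : a <= s <= b -> m <= t ->
   (if t <= m then Phi1 (s, t) else Phi2 (s, t) + D a) = Phi2 (s, t) + D a.
  move=> hs; rewrite le_eqVlt => /orP[/eqP <-|]; last by rewrite leNgt => ->.
  by rewrite lexx (DE s hs) /D; lra.
move=> i s1 s2 t1 t2 Oi as1 s12 s2b ct1 t12 t2d HU s t hs ht /=.
have [t2m|mt2] := leP t2 m.
  rewrite !low; [|lra|lra].
  exact: (L1 i s1 s2 t1 t2).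
have [mt1|t1m] := leP m t1.
  rewrite !up; [|lra|lra|lra|lra].
  have := L2 i s1 s2 t1 t2 Oi as1 s12 s2b mt1 t12 t2d HU s t hs ht; lra.
have HU1 u v : s1 <= u <= s2 -> t1 <= v <= m -> U i (F (u, v)).
  by move=> ? ?; apply: HU; lra.
have HU2 u v : s1 <= u <= s2 -> m <= v <= t2 -> U i (F (u, v)).
  by move=> ? ?; apply: HU; lra.
have t1m' := ltW t1m; have mt2' := ltW mt2.
have K1 := L1 i s1 s2 t1 m Oi as1 s12 s2b ct1 t1m' (lexx m) HU1.
have K2 := L2 i s1 s2 m t2 Oi as1 s12 s2b (lexx m) mt2' t2d HU2.
have [tm|mt] := leP t m.
  by rewrite !low //; apply: K1 => //; lra.
rewrite low; last lra.
have E2 := K2 s t hs.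
have E1 := K1 s1 m.
have E3 := DE s1.
move: E3; rewrite {2}/D; lra.
Qed.

(** Near a point of the square, the local primitive around its image is a lift.
    Induction over t extends this to a strip of positive width around each
    vertical segment, and induction over s extends it from strips to the
    square. *)
Lemma square_lifts_exist F : square_map F ->
  exists Phi, square_lifts F Phi 0 1 0 1.
Proof.
move=> Fc.
pose P x y := exists Phi, square_lifts F Phi x y 0 1.
have FcT : square_map (transpose F).
  move=> s t hs ht; have [Oi [e e0 He]] := Fc t s ht hs; split => //.
  by exists e => // ? ? ? ? ? ?; apply: He.
apply: (interval_ind (P := P)) => //.
  move=> x y z x0 xy yz z1 [Phi1 L1] [Phi2 L2].
  have [] := @square_lifts_cat (transpose F) (transpose Phi1) (transpose Phi2)
    0 1 x y z FcT => //.
  - exact: (square_lifts_transpose L1).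
  - exact: (square_lifts_transpose L2).
  move=> Phi L; exists (transpose Phi).
  exact: (square_lifts_transpose L).
move=> s hs.
pose Q c d := exists2 e : R, 0 < e & forall x y : R, 0 <= x -> x <= s -> s <= y ->
  y <= 1 -> s - e < x -> y < s + e -> exists Phi, square_lifts F Phi x y c d.
apply: (interval_ind (P := Q)) => //.
  move=> c m d c0 cm md d1 [e1 e10 H1] [e2 e20 H2].
  exists (Num.min e1 e2); first by rewrite lt_min e10.
  move=> x y x0 xs sy y1 xe ye.
  have le1 : Num.min e1 e2 <= e1 by rewrite ge_min lexx.
  have le2 : Num.min e1 e2 <= e2 by rewrite ge_min lexx orbT.
  have [Phi1 L1] : exists Phi, square_lifts F Phi x y c m by apply: H1 => //; lra.
  have [Phi2 L2] : exists Phi, square_lifts F Phi x y m d by apply: H2 => //; lra.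
  apply: (@square_lifts_cat F Phi1 Phi2 x y c m d) => //; lra.
move=> t ht; have [Oi [e e0 He]] := Fc s t hs ht.
exists e => // c d c0 ct td d1 ce de; exists e => // x y x0 xs sy y1 xe ye.
exists (fun z => h (F (s, t)) (F z)).
move=> i s1 s2 t1 t2 Oi' as1 s12 s2b ct1 t12 t2d HU s' t' hs' ht'.
have := @coherent (F (s, t)) i (F (s', t')) (F (s1, t1)) Oi Oi'.
have U1 : U (F (s, t)) (F (s', t')) by apply: He; lra.
have U2 : U (F (s, t)) (F (s1, t1)) by apply: He; lra.
have U3 : U i (F (s', t')) by apply: HU; lra.
have U4 : U i (F (s1, t1)) by apply: HU; lra.
move=> /(_ U1 U3 U2 U4); lra.
Qed.


(** [reach p0 p v]: some path from p0 to p has integral v. *)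
Definition reach (p0 p : R * R) (v : R) :=
  exists (c : R -> R * R) (phi : R -> R),
  [/\ continuous c, (forall t, 0 <= t <= 1 -> Omega (c t)), c 0 = p0 /\ c 1 = p,
      lifts c phi 0 1 & phi 1 - phi 0 = v].

Lemma reach_refl p : Omega p -> reach p p 0.
Proof.
move=> Op; exists (cst p), (cst 0); split => //.
- by move=> t; apply: cvg_cst.
- by move=> i s t *; rewrite /cst /=; lra.
- by rewrite subrr.
Qed.

(** The path is prolonged by the segment from p to q.  To write it without a
    case distinction, the time is clamped: the old path runs at time
    [min (2 t) 1], and [max (2 t - 1) 0] is the position on the segment. *)
Lemma reach_step p0 i p q v : Omega i -> U i `<=` Omega -> U i p -> U i q ->
  reach p0 p v -> reach p0 q (v + (h i q - h i p)).
Proof.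
move=> Oi UO Uip Uiq [c [phi [cc cO [c0 c1] L <-]]].
pose m t : R := Num.min (2 * t) 1.
pose M t : R := Num.max (2 * t - 1) 0.
have mM_low t : t <= 2^-1 -> m t = 2 * t /\ M t = 0.
  by move=> t2; rewrite /m /M min_l ?max_r //; lra.
have mM_up t : 2^-1 <= t -> m t = 1 /\ M t = 2 * t - 1.
  by move=> t2; rewrite /m /M min_r ?max_l //; lra.
pose c' (t : R) := c (m t) + M t *: (q - p).
have c'_low t : t <= 2^-1 -> c' t = c (2 * t).
  by move=> /mM_low[mt Mt]; rewrite /c' mt Mt scale0r addr0.
have c'_up t : 2^-1 <= t -> c' t = p + (2 * t - 1) *: (q - p).
  by move=> /mM_up[mt Mt]; rewrite /c' mt Mt c1.
have Uc' t : 2^-1 <= t -> t <= 1 -> U i (c' t).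
  by move=> t1 t2; rewrite c'_up //; apply: segment_in_ball => //; lra.
pose phi' (t : R) := phi (m t) + (h i (p + M t *: (q - p)) - h i p).
have phi'_low t : t <= 2^-1 -> phi' t = phi (2 * t).
  by move=> /mM_low[mt Mt]; rewrite /phi' mt Mt scale0r addr0 subrr addr0.
have phi'_up t : 2^-1 <= t -> phi' t = phi 1 + (h i (c' t) - h i p).
  by move=> t2; rewrite c'_up // /phi'; have [-> ->] := mM_up _ t2.
have Epq : p + (q - p) = q by rewrite addrCA subrr addr0.
have E21 : 2 * 1 - 1 = 1 :> R by lra.
exists c', phi'; split.
- move=> t; apply: cvgD.
    apply: (@continuous_comp _ _ _ m c); last exact: cc.
    exact: (@continuous_min_cst R (fun t => 2 * t) 1 (@continuous_double R) t).
  apply: cvgZr_tmp; apply: (@continuous_max_cst _ (fun t => 2 * t - 1)) => u.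
  by apply: cvgB; [exact: continuous_double | exact: cvg_cst].
- move=> t ht; have [t2|t2] := leP t 2^-1.
    by rewrite c'_low //; apply: cO; lra.
  by apply: UO; apply: Uc'; lra.
- rewrite c'_low ?c'_up; [|lra..].
  rewrite mulr0; split => //.
  by rewrite E21 scale1r Epq.
- apply: (@lifts_cat _ _ _ 2^-1).
    move=> j s t Oj s0 st t2 HU.
    have s2 : s <= 2^-1 by lra.
    rewrite !phi'_low ?c'_low //.
    apply: L => //; [lra|lra|lra|move=> u hu].
    have := HU (u / 2); rewrite c'_low; last lra.
    by rewrite (_ : 2 * (u / 2) = u); [apply; lra | field].
  move=> j s t Oj s2 st t1 HU; have t2 : 2^-1 <= t by lra.
  rewrite !phi'_up //.
  have Ujs : U j (c' s) by apply: HU; lra.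
  have Ujt : U j (c' t) by apply: HU; lra.
  have Uis : U i (c' s) by apply: Uc'; lra.
  have Uit : U i (c' t) by apply: Uc'; lra.
  have := coherent Oi Oj Uis Ujs Uit Ujt; lra.
- rewrite (phi'_low 0) ?(phi'_up 1); [|lra..].
  rewrite c'_up; last by lra.
  by rewrite E21 mulr0 scale1r Epq; lra.
Qed.

(** The lift over the square of a null-homotopy takes the same value at the four
    corners, because three sides are mapped to the base point.  On the fourth
    side it is a lift of the loop itself. *)
Lemma null_homotopic_lift (c : R -> R * R) (phi : R -> R) : continuous c ->
  (forall t, 0 <= t <= 1 -> Omega (c t)) ->
  null_homotopic_in Omega c -> lifts c phi 0 1 -> phi 1 = phi 0.
Proof.
move=> cc cO [F [Fc FO F0 F1 Fs]] L.
have itv01 (x : R) : 0 <= x <= 1 -> `[0, 1]%classic x.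
  by move=> hx; rewrite /= in_itv /= hx.
have F_sq : square_map F.
  move=> s t hs ht.
  have Ost : (`[0, 1]%classic `*` `[0, 1]%classic) (s, t) by split; apply: itv01.
  have OF : Omega (F (s, t)) by apply: FO; exists (s, t).
  split => //; move/subspace_continuousP : Fc => /(_ _ Ost).
  move=> /(_ _ (nbhsx_ballx _ _ (rad_gt0 OF))).
  move=> /nbhs_ballP[e /= e0 He]; exists e => // s' t' hs' ht' hs'' ht''.
  apply: (He (s', t')); last by split; apply: itv01.
  by apply/ball_coord; split; rewrite ltr_norml /=; lra.
have [Phi LPhi] := square_lifts_exist F_sq.
have le00 : 0 <= (0 : R) <= 0 by lra.
have h01 : 0 <= (0 : R) <= 1 by lra.
have h11 : 0 <= (1 : R) <= 1 by lra.
have Oc0 : Omega (c 0) by apply: cO; lra.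
have Uc0 : U (c 0) (c 0) by apply: ballxx; exact: rad_gt0.
have LPhi0 : lifts c (fun t => Phi (0, t)) 0 1.
  move=> i s t Oi s0 st t1 HU.
  have LPhi' := LPhi i 0 0 s t Oi.
  rewrite -(F0 s) -?(F0 t); [|lra..].
  suff : Phi (0, t) - h i (F (0, t)) = Phi (0, s) - h i (F (0, s)) by lra.
  apply: LPhi' => //; try lra.
  move=> u v hu hv; rewrite (_ : u = 0); last by lra.
  by rewrite F0; [exact: HU | lra].
have -> : phi 1 = phi 0 + (Phi (0, 1) - Phi (0, 0)).
  by rewrite (lifts_unique _ cc cO LPhi0 L) //; lra.
have edge_s t : t = 0 \/ t = 1 -> Phi (1, t) = Phi (0, t).
  move=> ht; have Ft s : 0 <= s <= 1 -> F (s, t) = c 0.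
    by move=> /Fs [? ?]; case: ht => ->.
  have t01 : 0 <= t <= 1 by case: ht => ->; lra.
  have := LPhi (c 0) 0 1 t t Oc0; rewrite /= => /(_ _ _ _ _ _ _ _ 1 t).
  rewrite !Ft //; move=> K.
  suff : Phi (1, t) - h (c 0) (c 0) = Phi (0, t) - h (c 0) (c 0) by lra.
  apply: K => //; try lra.
  move=> s t' hs ht'; rewrite (_ : t' = t); last by lra.
  by rewrite Ft.
have : Phi (1, 1) = Phi (1, 0).
  have := LPhi (c 0) 1 1 0 1 Oc0; rewrite /= => /(_ _ _ _ _ _ _ _ 1 1).
  rewrite !F1 //; move=> K.
  suff : Phi (1, 1) - h (c 0) (c 0) = Phi (1, 0) - h (c 0) (c 0) by lra.
  apply: K => //; try lra.
  move=> s t hs ht; rewrite (_ : s = 1); last by lra.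
  by rewrite F1.
by rewrite !edge_s; [lra|left|right].
Qed.

(** Following the first path and then the second one backwards gives a loop, on
    which the integral is the difference of the two values.  While one
    path runs the other rests at p, so the loop is their sum minus p. *)
Lemma reach_unique p0 p v w :
  (forall c, loop_in Omega c -> null_homotopic_in Omega c) ->
  reach p0 p v -> reach p0 p w -> v = w.
Proof.
move=> sc [c [phi [cc cO [c0 c1] L Ephi]]] [d [psi [dc dO [d0 d1] L' Epsi]]].
pose m t : R := Num.min (2 * t) 1.
pose n t : R := Num.min (2 - 2 * t) 1.
have mn_low t : t <= 2^-1 -> m t = 2 * t /\ n t = 1.
  by move=> t2; rewrite /m /n min_l ?min_r //; lra.
have mn_up t : 2^-1 <= t -> m t = 1 /\ n t = 2 - 2 * t.
  by move=> t2; rewrite /m /n min_r ?min_l //; lra.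
pose e (t : R) := c (m t) + (d (n t) - p).
pose chi (t : R) := phi (m t) + (psi (n t) - psi 1).
have e_low t : t <= 2^-1 -> e t = c (2 * t).
  by move=> /mn_low[mt nt]; rewrite /e mt nt d1 subrr addr0.
have e_up t : 2^-1 <= t -> e t = d (2 - 2 * t).
  by move=> /mn_up[mt nt]; rewrite /e mt nt c1 addrCA subrr addr0.
have chi_low t : t <= 2^-1 -> chi t = phi (2 * t).
  by move=> /mn_low[mt nt]; rewrite /chi mt nt subrr addr0.
have chi_up t : 2^-1 <= t -> chi t = phi 1 + (psi (2 - 2 * t) - psi 1).
  by move=> /mn_up[mt nt]; rewrite /chi mt nt.
have ec : continuous e.
  move=> t; apply: cvgD.
    apply: (@continuous_comp _ _ _ m c); last exact: cc.
    exact: (@continuous_min_cst R (fun t => 2 * t) 1 (@continuous_double R) t).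
  apply: cvgB; last exact: cvg_cst.
  apply: (@continuous_comp _ _ _ n d); last exact: dc.
  apply: (@continuous_min_cst _ (fun t => 2 - 2 * t)) => u.
  by apply: cvgB; [exact: cvg_cst | exact: continuous_double].
have eO t : 0 <= t <= 1 -> Omega (e t).
  move=> ht; have [t2|t2] := leP t 2^-1.
    by rewrite e_low //; apply: cO; lra.
  by rewrite e_up ?(ltW t2) //; apply: dO; lra.
have Le : lifts e chi 0 1.
  apply: (@lifts_cat _ _ _ 2^-1) => i s t Oi s0 st t1 HU.
    have s2 : s <= 2^-1 by lra.
    rewrite !chi_low ?e_low //; apply: L => //; [lra|lra|lra|move=> u hu].
    have := HU (u / 2); rewrite e_low; last lra.
    by rewrite (_ : 2 * (u / 2) = u); [apply; lra | field].
  have t2 : 2^-1 <= t by lra.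
  rewrite !chi_up ?e_up //.
  suff : psi (2 - 2 * s) - psi (2 - 2 * t) =
         h i (d (2 - 2 * s)) - h i (d (2 - 2 * t)) by lra.
  apply: L' => //; [lra|lra|lra|move=> u hu].
  have := HU (1 - u / 2); rewrite e_up; last lra.
  by rewrite (_ : 2 - 2 * (1 - u / 2) = u); [apply; lra | field].
have loop_e : loop_in Omega e.
  split.
  - exact: continuous_subspaceT.
  - by move=> _ [t + <-]; rewrite /= in_itv /= => ht; apply: eO.
  - rewrite (e_low 0) ?(e_up 1); [|lra..].
    by rewrite mulr0 mulr1 subrr c0 d0.
have := null_homotopic_lift ec eO (sc e loop_e) Le.
rewrite (chi_low 0) ?(chi_up 1); [|lra..].
rewrite mulr0 mulr1 subrr; lra.
Qed.

(** For each q in a ball around i, a path to i can be continued by a segment to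
    q and conversely, so the set of points that are reached is open and closed
    in Omega; [reach_unique] makes the value a function of the end point. *)
Theorem monodromy : simply_connected_domain Omega ->
  (forall i, Omega i -> U i `<=` Omega) ->
  exists g : R * R -> R, forall i p q, Omega i -> U i p -> U i q ->
    g p - g q = h i p - h i q.
Proof.
move=> [[[p0 Op0] oO cO] sc] UO.
have reach_all p : Omega p -> exists v, reach p0 p v.
  move: p; apply: (connected_ind cO).
    by exists p0 => //; exists 0; exact: reach_refl.
  move=> p Op; exists (interior (U p)).
    split; first exact: open_interior.
    exact: (nbhsx_ballx p _ (rad_gt0 Op)).
  move=> q Oq /nbhs_singleton Upq.
  have Upp : U p p by apply: ballxx; exact: rad_gt0.
  by split => -[v rv]; eexists; apply: (reach_step Op (UO _ Op) _ _ rv).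
pose g p := if pselect (exists v, reach p0 p v) is left e then projT1 (cid e) else 0.
have gP p : Omega p -> reach p0 p (g p).
  move=> /reach_all e; rewrite /g; case: pselect => // e'.
  exact: (projT2 (cid e')).
exists g => i p q Oi Up Uq.
have := reach_step Oi (UO _ Oi) Up Uq (gP _ (UO _ Oi _ Up)).
by move=> /(reach_unique sc (gP _ (UO _ Oi _ Uq))) ->; lra.
Qed.

End Monodromy.

(** * Partial derivatives *)

Section Partials.
Variable R : realType.
Implicit Types (f g u v h : R * R -> R) (p q : R * R).

Definition partial_x f p (d : R) := is_derive p ((1, 0) : R * R) f d.
Definition partial_y f p (d : R) := is_derive p ((0, 1) : R * R) f d.

(** Reduction to one variable: the difference quotients are the same. *)
Lemma partial_xE f x y d :
  partial_x f (x, y) d <-> is_derive x (1 : R) (fun t => f (t, y)) d.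
Proof.
have E :
    (fun k : R =>
       k^-1 *: ((f \o shift (x, y)) (k *: ((1, 0) : R * R)) - f (x, y))) =
    (fun k : R =>
       k^-1 *: (((fun t => f (t, y)) \o shift x) (k *: (1 : R)) - f (x, y))).
  apply/funext => k /=; congr (_ *: (f _ - _)).
  by congr pair; rewrite /= scaler0 add0r.
by split => -[D V]; split; move: D V; rewrite /derivable /derive E.
Qed.

Lemma partial_yE f x y d :
  partial_y f (x, y) d <-> is_derive y (1 : R) (fun t => f (x, t)) d.
Proof.
have E :
    (fun k : R =>
       k^-1 *: ((f \o shift (x, y)) (k *: ((0, 1) : R * R)) - f (x, y))) =
    (fun k : R =>
       k^-1 *: (((fun t => f (x, t)) \o shift y) (k *: (1 : R)) - f (x, y))).
  apply/funext => k /=; congr (_ *: (f _ - _)).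
  by congr pair; rewrite /= scaler0 add0r.
by split => -[D V]; split; move: D V; rewrite /derivable /derive E.
Qed.

Lemma mean_value (f df : R -> R) (a b : R) :
  (forall t, Num.min a b <= t <= Num.max a b -> is_derive t (1 : R) f (df t)) ->
  exists2 c, Num.min a b <= c <= Num.max a b & f b - f a = df c * (b - a).
Proof.
have main (x y : R) : x <= y ->
    (forall t, x <= t <= y -> is_derive t (1 : R) f (df t)) ->
    exists2 c, x <= c <= y & f y - f x = df c * (y - x).
  move=> xy fD; have [||c cxy ->] := @MVT_segment R f df x y xy.
  - by move=> t /andP[]; rewrite !bnd_simp => xt ty; apply: fD; rewrite !ltW.
  - apply: derivable_within_continuous => t; rewrite in_itv /= => /fD[D _].
    exact: D.
  - by exists c => //; move: cxy; rewrite in_itv.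
have [ab|ba] := leP a b.
  by move=> fD; apply: main.
move=> fD; have [c hc E] := main b a (ltW ba) fD.
by exists c => //; lra.
Qed.

Lemma between_ball (c r a b t : R) : `|c - a| < r -> `|c - b| < r ->
  Num.min a b <= t <= Num.max a b -> `|c - t| < r.
Proof. by rewrite !ltr_norml; case: (leP a b) => *; lra. Qed.

Lemma mean_value_x f fx (a b y : R) :
  (forall t, Num.min a b <= t <= Num.max a b -> partial_x f (t, y) (fx (t, y))) ->
  exists2 c, Num.min a b <= c <= Num.max a b &
    f (b, y) - f (a, y) = fx (c, y) * (b - a).
Proof.
move=> fD; apply: (@mean_value (fun t => f (t, y)) (fun t => fx (t, y))).
by move=> t /fD /partial_xE.
Qed.

Lemma mean_value_y f fy (x a b : R) :
  (forall t, Num.min a b <= t <= Num.max a b -> partial_y f (x, t) (fy (x, t))) ->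
  exists2 c, Num.min a b <= c <= Num.max a b &
    f (x, b) - f (x, a) = fy (x, c) * (b - a).
Proof.
move=> fD; apply: (@mean_value (fun t => f (x, t)) (fun t => fy (x, t))).
by move=> t /fD /partial_yE.
Qed.

(** Balls are squares, so the corner (q.1, p.2) lies in both of them, and so do
    the two sides that join it to p and to q; on each side the difference has
    zero derivative. *)
Lemma primitives_differ_by_constant h h' P Q i j (r s : R) p q :
  (forall z, ball i r z -> partial_x h z (P z) /\ partial_y h z (Q z)) ->
  (forall z, ball j s z -> partial_x h' z (P z) /\ partial_y h' z (Q z)) ->
  ball i r p -> ball j s p -> ball i r q -> ball j s q ->
  h p - h q = h' p - h' q.
Proof.
case: p q => [px py] [qx qy] hP hP'.
move=> /ball_coord[/= ip1 ip2] /ball_coord[/= jp1 jp2].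
move=> /ball_coord[/= iq1 iq2] /ball_coord[/= jq1 jq2].
have D z : ball i r z -> ball j s z ->
    partial_x (fun z => h z - h' z) z 0 /\ partial_y (fun z => h z - h' z) z 0.
  move=> /hP[hx hy] /hP'[hx' hy'].
  rewrite -{1}(subrr (P z)) -(subrr (Q z)).
  by split; apply: is_deriveB.
have [t ht|c _ /= E1] := @mean_value_x (fun z => h z - h' z) (fun=> 0) px qx py.
  have [||//] := D (t, py); apply/ball_coord; split => //=; exact: between_ball ht.
have [t ht|c' _ /= E2] := @mean_value_y (fun z => h z - h' z) (fun=> 0) qx py qy.
  have [||//] := D (qx, t); apply/ball_coord; split => //=; exact: between_ball ht.
lra.
Qed.

Lemma continuousP_eps u p : {for p, continuous u} <->
  forall e : R, 0 < e -> exists2 r : R, 0 < r & forall q, ball p r q -> `|u p - u q| < e.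
Proof.
split => [/cvgrPdist_lt cu e e0|cu].
  by have /nbhs_ballP[r /= r0 Hr] := cu e e0; exists r.
suff : forall e : R, 0 < e -> \forall q \near nbhs p, `|u p - u q| < e.
  by move/cvgrPdist_lt.
move=> e e0; have [r r0 Hr] := cu e e0; by apply/nbhs_ballP; exists r.
Qed.

Lemma ball_shrink p q (r s : R) : s <= r -> ball p s q -> ball p r q.
Proof. by move=> sr; apply: (le_ball sr). Qed.

(** Two applications of the mean value theorem to the difference of f over the
    vertices of a small square. *)
Lemma second_difference_xy f fx fxy p (k r : R) : 0 < k < r ->
  (forall q, ball p r q -> partial_x f q (fx q) /\ partial_y fx q (fxy q)) ->
  exists2 q, ball p r q &
    f (p.1 + k, p.2 + k) - f (p.1, p.2 + k) - (f (p.1 + k, p.2) - f p) =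
    fxy q * k ^+ 2.
Proof.
case: p => a b hk fD /=.
have inr t : a <= t <= a + k -> `|a - t| < r by rewrite ltr_norml; lra.
have inr' t : b <= t <= b + k -> `|b - t| < r by rewrite ltr_norml; lra.
have mk (x : R) : Num.min x (x + k) = x /\ Num.max x (x + k) = x + k.
  by rewrite min_l ?max_r //; lra.
have [t|c] := @mean_value (fun t => f (t, b + k) - f (t, b))
    (fun t => fx (t, b + k) - fx (t, b)) a (a + k).
  have [-> ->] := mk a => ht; apply: is_deriveB; apply/partial_xE.
    have [|//] := fD (t, b + k); apply/ball_coord; split => /=; first exact: inr.
    by apply: inr'; lra.
  have [|//] := fD (t, b); apply/ball_coord; split => /=; first exact: inr.
  by apply: inr'; lra.
have [-> ->] := mk a => hc E.
have [t|d] := @mean_value_y fx fxy c b (b + k).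
  have [-> ->] := mk b => ht; have [|//] := fD (c, t).
  by apply/ball_coord; split => /=; [exact: inr | exact: inr'].
have [-> ->] := mk b => hd E'.
exists (c, d); first by apply/ball_coord; split => /=; [exact: inr | exact: inr'].
rewrite E' in E; lra.
Qed.

Let swap p := (p.2, p.1).

Lemma partial_y_swap f p d : partial_y f p d <-> partial_x (f \o swap) (swap p) d.
Proof.
case: p => x y; split => [/partial_yE D|D]; first exact/partial_xE.
by apply/partial_yE; exact: (iffLR (partial_xE (f \o swap) y x d) D).
Qed.

Lemma partial_x_swap f p d : partial_x f p d <-> partial_y (f \o swap) (swap p) d.
Proof.
case: p => x y; split => [/partial_xE D|D]; first exact/partial_yE.
by apply/partial_xE; exact: (iffLR (partial_yE (f \o swap) y x d) D).
Qed.

(** Clairaut's theorem: the second difference is symmetric in the two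
    coordinates, so on arbitrarily small squares some value of [fxy] is some
    value of [fyx]. *)
Lemma mixed_partials_eq f fx fy fxy fyx p (r : R) : 0 < r ->
  (forall q, ball p r q -> partial_x f q (fx q) /\ partial_y fx q (fxy q)) ->
  (forall q, ball p r q -> partial_y f q (fy q) /\ partial_x fy q (fyx q)) ->
  {for p, continuous fxy} -> {for p, continuous fyx} -> fxy p = fyx p.
Proof.
move=> r0 D1 D2 /continuousP_eps c1 /continuousP_eps c2.
apply/eqP; rewrite -subr_eq0 -normr_le0; apply/ler_addgt0Pr => e e0.
have e20 : 0 < e / 2 by lra.
have [r1 r10 H1] := c1 _ e20; have [r2 r20 H2] := c2 _ e20.
pose s := Num.min r (Num.min r1 r2).
have s0 : 0 < s by rewrite !lt_min r0 r10.
have sr : s <= r by rewrite ge_min lexx.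
have s1 : s <= r1 by rewrite !ge_min lexx orbT.
have s2 : s <= r2 by rewrite !ge_min lexx !orbT.
have hk : 0 < s / 2 < s by lra.
have [q|q pq E] := @second_difference_xy f fx fxy p _ _ hk.
  by move=> /(ball_shrink sr) /D1.
have [q'|q' pq' E'] := @second_difference_xy (f \o swap) (fy \o swap)
    (fyx \o swap) (swap p) _ _ hk.
  case: q' => [x y] [pq1 pq2]; have [|Dy Dyx] := D2 (y, x).
    by apply: (ball_shrink sr); split.
  split; first exact: (iffLR (partial_y_swap f (y, x) _) Dy).
  exact: (iffLR (partial_x_swap fy (y, x) _) Dyx).
have {}pq' : ball p s (swap q') by case: pq'.
have K : fxy q = fyx (swap q').
  have k2 : (s / 2) ^+ 2 != 0 by rewrite expf_neq0 // gt_eqF //; lra.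
  apply: (mulIf k2); rewrite -E; move: E' => /= <-.
  by rewrite /swap /= -surjective_pairing; lra.
have := H1 q (ball_shrink s1 pq); have := H2 (swap q') (ball_shrink s2 pq').
rewrite K !ltr_norml ler_norml; lra.
Qed.

(** Two sides of a rectangle join p to a nearby point, and the partial
    derivatives are bounded on them. *)
Lemma continuous_of_partials h P Q p (r : R) : 0 < r ->
  (forall q, ball p r q -> partial_x h q (P q) /\ partial_y h q (Q q)) ->
  {for p, continuous P} -> {for p, continuous Q} -> {for p, continuous h}.
Proof.
case: p => a b r0 hD /continuousP_eps cP /continuousP_eps cQ.
apply/continuousP_eps => e e0.
have [r1 r10 H1] := cP _ ltr01; have [r2 r20 H2] := cQ _ ltr01.
pose M := `|P (a, b)| + `|Q (a, b)| + 2.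
have P0 := normr_ge0 (P (a, b)); have Q0 := normr_ge0 (Q (a, b)).
have M0 : 0 < M by rewrite /M; lra.
have eM0 : 0 < e / M by rewrite divr_gt0.
pose s := Num.min (Num.min r (e / M)) (Num.min r1 r2).
have s0 : 0 < s by rewrite !lt_min r0 r10 eM0.
have sr : s <= r by rewrite !ge_min lexx.
have se : s <= e / M by rewrite !ge_min lexx orbT.
have s1 : s <= r1 by rewrite !ge_min lexx !orbT.
have s2 : s <= r2 by rewrite !ge_min lexx !orbT.
exists s => // -[x y] /ball_coord[/= xs ys].
have as_ : `|a - a| < s by rewrite subrr normr0.
have bs : `|b - b| < s by rewrite subrr normr0.
have [t ht|c hc E1] := @mean_value_x h P a x y.
  have [|//] := hD (t, y); apply: (ball_shrink sr).
  by apply/ball_coord; split => //=; apply: between_ball ht.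
have [t ht|d hd E2] := @mean_value_y h Q a b y.
  have [|//] := hD (a, t); apply: (ball_shrink sr).
  by apply/ball_coord; split => //=; apply: between_ball ht.
have HP : `|P (a, b) - P (c, y)| < 1.
  apply: H1; apply: (ball_shrink s1).
  by apply/ball_coord; split => //=; apply: between_ball hc.
have HQ : `|Q (a, b) - Q (a, d)| < 1.
  apply: H2; apply: (ball_shrink s2).
  by apply/ball_coord; split => //=; apply: between_ball hd.
have NP : `|P (c, y)| <= `|P (a, b)| + 1.
  have := ler_normB (P (a, b)) (P (a, b) - P (c, y)).
  rewrite (_ : P (a, b) - (P (a, b) - P (c, y)) = P (c, y)); last by lra.
  by lra.
have NQ : `|Q (a, d)| <= `|Q (a, b)| + 1.
  have := ler_normB (Q (a, b)) (Q (a, b) - Q (a, d)).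
  rewrite (_ : Q (a, b) - (Q (a, b) - Q (a, d)) = Q (a, d)); last by lra.
  by lra.
have -> : h (a, b) - h (x, y) = P (c, y) * (a - x) + Q (a, d) * (b - y) by lra.
have NPc := normr_ge0 (P (c, y)); have NQd := normr_ge0 (Q (a, d)).
have Na := normr_ge0 (a - x); have Nb := normr_ge0 (b - y).
have Ms : M * s <= e by rewrite mulrC -ler_pdivlMr.
apply: (le_lt_trans (ler_normD _ _)); rewrite !normrM.
have : `|P (c, y)| * `|a - x| <= (`|P (a, b)| + 1) * `|a - x| by apply: ler_wpM2r.
have : (`|P (a, b)| + 1) * `|a - x| < (`|P (a, b)| + 1) * s by rewrite ltr_pM2l //; lra.
have : `|Q (a, d)| * `|b - y| <= (`|Q (a, b)| + 1) * `|b - y| by apply: ler_wpM2r.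
have : (`|Q (a, b)| + 1) * `|b - y| < (`|Q (a, b)| + 1) * s by rewrite ltr_pM2l //; lra.
move: Ms; rewrite /M; lra.
Qed.

End Partials.

(** * Primitives of closed fields on a square *)

(** The radius is halved so that the integral may start at [c - r / 2], on a
    closed segment where u is continuous. *)
Lemma antiderivative (R : realType) (u : R -> R) (c r : R) : 0 < r ->
  (forall t, `|c - t| < r -> {for t, continuous u}) ->
  exists U : R -> R, forall t, `|c - t| < r / 2 -> is_derive t (1 : R) U (u t).
Proof.
move=> r0 cu; pose a := c - r / 2; pose b := c + r / 2.
have ab : a < b by rewrite /a /b; lra.
have int_u : (@lebesgue_measure R).-integrable `[a, b] (EFin \o u).
  apply: continuous_compact_integrable; first exact: segment_compact.
  apply: continuous_in_subspaceT => t; rewrite inE /= in_itv /= => ht.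
  by apply: cu; rewrite ltr_norml; move: ht; rewrite /a /b; lra.
exists (fun x => (\int[lebesgue_measure]_(t in `[a, x]) u t)%R) => t ht.
move: (ht); rewrite ltr_norml => ht'.
have tb : t < b by rewrite /b; lra.
have at_ : a < t by rewrite /a; lra.
have [] := continuous_FTC1_closed tb int_u at_ (cu t _).
  by apply: lt_le_trans ht _; lra.
by rewrite derive1E => D E; apply: DeriveDef.
Qed.

Lemma is_derive_eps (R : realType) (f : R -> R) (x d : R) :
  (forall e : R, 0 < e -> exists2 r : R, 0 < r &
     forall k, `|k| < r -> `|f (x + k) - f x - d * k| <= e * `|k|) ->
  is_derive x (1 : R) f d.
Proof.
move=> H; suff L : (k^-1 *: ((f \o shift x) (k *: (1 : R)) - f x)) @[k --> 0^'] --> d.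
  by apply: DeriveDef; [apply/cvg_ex; exists d | exact: cvg_lim].
apply/cvgrPdist_le => e e0; have [r r0 Hr] := H e e0.
near=> k.
have k0 : k != 0 by near: k; exact: nbhs_dnbhs_neq.
have kr : `|k| < r by near: k; exact: dnbhs0_lt.
have nk0 : 0 < `|k| by rewrite normr_gt0.
rewrite -(ler_pM2r nk0) -normrM /= -normrN.
rewrite (_ : - (_ * k) = f (x + k) - f x - d * k); first exact: Hr.
by rewrite /GRing.scale /= mulr1 (addrC k x); field.
Unshelve. all: by end_near. Qed.

(** S is the common value of [P_y] and [Q_x]. *)
Section LocalPrimitive.
Variables (R : realType) (P Q S : R * R -> R) (a b r : R).
Hypothesis r0 : 0 < r.
Hypothesis cP : forall z, ball (a, b) r z -> {for z, continuous P}.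
Hypothesis cQ : forall z, ball (a, b) r z -> {for z, continuous Q}.
Hypothesis cS : forall z, ball (a, b) r z -> {for z, continuous S}.
Hypothesis PS : forall z, ball (a, b) r z -> partial_y P z (S z).
Hypothesis QS : forall z, ball (a, b) r z -> partial_x Q z (S z).

Lemma continuous_slice_x (f : R * R -> R) (x y : R) :
  {for (x, y), continuous f} -> {for x, continuous (fun t => f (t, y))}.
Proof.
move=> /continuousP_eps cf.
suff : forall e : R, 0 < e -> \forall t \near nbhs x, `|f (x, y) - f (t, y)| < e.
  by move/cvgrPdist_lt.
move=> e e0; have [s s0 Hs] := cf e e0.
by apply/nbhs_ballP; exists s => // t ht; apply: Hs; split => //; exact: ballxx.
Qed.

Lemma continuous_slice_y (f : R * R -> R) (x y : R) :
  {for (x, y), continuous f} -> {for y, continuous (fun t => f (x, t))}.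
Proof.
move=> /continuousP_eps cf.
suff : forall e : R, 0 < e -> \forall t \near nbhs y, `|f (x, y) - f (x, t)| < e.
  by move/cvgrPdist_lt.
move=> e e0; have [s s0 Hs] := cf e e0.
by apply/nbhs_ballP; exists s => // t ht; apply: Hs; split => //; exact: ballxx.
Qed.

(** Tube lemma: S is uniformly continuous at the points of a vertical segment. *)
Lemma uniform_near_slice (x c d e : R) : `|a - x| < r -> c <= d ->
  (forall s, c <= s <= d -> `|b - s| < r) -> 0 < e ->
  exists2 eta : R, 0 < eta & forall k s, `|k| < eta -> c <= s <= d ->
    ball (a, b) r (x + k, s) /\ `|S (x + k, s) - S (x, s)| <= e.
Proof.
move=> ax cd hb e0.
pose good c' d' := exists2 eta : R, 0 < eta &
  forall k s : R, `|k| < eta -> c' <= s <= d' ->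
    ball (a, b) r (x + k, s) /\ `|S (x + k, s) - S (x, s)| <= e.
apply: (interval_ind (P := good)) => //.
  move=> c' m d' _ cm md _ [e1 e10 H1] [e2 e20 H2].
  exists (Num.min e1 e2); first by rewrite lt_min e10.
  move=> k s; rewrite lt_min => /andP[k1 k2] hs.
  by have [sm|ms] := leP s m; [apply: H1 | apply: H2] => //; lra.
move=> t ht; have bt := hb t ht.
have Bt : ball (a, b) r (x, t) by apply/ball_coord.
have e20 : 0 < e / 2 by lra.
have [s1 s10 H1] := iffLR (continuousP_eps S (x, t)) (cS Bt) _ e20.
pose eta := Num.min s1 (Num.min (r - `|a - x|) (r - `|b - t|)).
have eta0 : 0 < eta by rewrite !lt_min s10 !subr_gt0 ax bt.
have eta1 : eta <= s1 by rewrite ge_min lexx.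
have eta2 : eta <= r - `|a - x| by rewrite !ge_min lexx !orbT.
have eta3 : eta <= r - `|b - t| by rewrite !ge_min lexx !orbT.
exists eta => // c' d' cc' ct td dd' ec ed; exists eta => // k s hk hs.
have ts : `|t - s| < eta by rewrite ltr_norml; lra.
split.
  apply/ball_coord; split => /=.
    have := ler_normB (a - x) k; rewrite opprD addrA; lra.
  have := ler_normD (b - t) (t - s).
  rewrite (_ : b - t + (t - s) = b - s); last by lra.
  by lra.
have K1 : `|S (x, t) - S (x + k, s)| < e / 2.
  apply: H1; apply: (ball_shrink eta1); apply/ball_coord; split => //=.
  by rewrite opprD addNKr normrN.
have K2 : `|S (x, t) - S (x, s)| < e / 2.
  apply: H1; apply: (ball_shrink eta1); apply/ball_coord; split => //=.
  by rewrite subrr normr0.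
by move: K1 K2; rewrite !ltr_norml ler_norml; lra.
Qed.

(** [V x y] is the integral of Q (x, s) over s from b to y, and the formula is
    [int_b^y Q_x = int_b^y P_y].  The error
    [V (x + k) s - V x s - k P (x, s)] has s-derivative
    [Q (x + k, s) - Q (x, s) - k S (x, s)], which by the mean value theorem for Q
    is k times a difference of values of S, hence uniformly small with respect
    to k. *)
Lemma differentiate_under_integral (V : R -> R -> R) :
  (forall x, `|a - x| < r -> V x b = 0) ->
  (forall x y, `|a - x| < r -> `|b - y| < r / 2 ->
     is_derive y (1 : R) (V x) (Q (x, y))) ->
  forall x y, `|a - x| < r -> `|b - y| < r / 2 ->
    is_derive x (1 : R) (fun t => V t y) (P (x, y) - P (x, b)).
Proof.
move=> Vb VQ x y ax by_; have rpos := r0.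
have bb : `|b - b| < r / 2 by rewrite subrr normr0 divr_gt0.
have btw t : Num.min b y <= t <= Num.max b y -> `|b - t| < r / 2.
  exact: between_ball.
have btw' t : Num.min b y <= t <= Num.max b y -> `|b - t| < r.
  by move=> /btw ht; apply: lt_le_trans ht _; lra.
apply: is_derive_eps => e e0.
have er0 : 0 < e / r by rewrite divr_gt0.
have [|eta eta0 Heta] :=
    @uniform_near_slice x (Num.min b y) (Num.max b y) _ ax _ btw' er0.
  by rewrite ge_min !le_max lexx.
exists eta => // k hk.
pose E s := V (x + k) s - V x s - k * P (x, s).
have axk s : Num.min b y <= s <= Num.max b y -> `|a - (x + k)| < r.
  by move=> hs; have [/ball_coord[]] := Heta k s hk hs.
have [s hs|s hs EE] := @mean_value R E
    (fun s => Q (x + k, s) - Q (x, s) - k * S (x, s)) b y.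
  apply: is_deriveB.
    by apply: is_deriveB; apply: VQ => //; [exact: axk hs | exact: btw | exact: btw].
  have /partial_yE D : partial_y P (x, s) (S (x, s)).
    by apply: PS; apply/ball_coord; split => //=; exact: btw'.
  exact: is_deriveZ.
have hb : Num.min b y <= b <= Num.max b y by rewrite ge_min le_max lexx.
have minmax (u : R) : Num.min x (x + k) <= u <= Num.max x (x + k) ->
    u = x + (u - x) /\ `|u - x| <= `|k|.
  split; first by lra.
  have := ler_norm k; have := ler_norm (- k); rewrite normrN ler_norml.
  by case: (leP x (x + k)) H => *; lra.
have [u hu|u hu EQ] := @mean_value_x R Q S x (x + k) s.
  have [Eu uk] := minmax u hu; apply: QS; rewrite Eu.
  by have [] := Heta (u - x) s (le_lt_trans uk hk) hs.
have [Eu uk] := minmax u hu.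
have [_ HS] := Heta (u - x) s (le_lt_trans uk hk) hs.
rewrite -Eu in HS.
have -> : V (x + k) y - V x y - (P (x, y) - P (x, b)) * k =
          k * ((S (u, s) - S (x, s)) * (y - b)).
  move: EE; rewrite /E (Vb _ (axk b hb)) (Vb _ ax).
  rewrite (_ : Q (x + k, s) - Q (x, s) = S (u, s) * k); last by rewrite EQ; lra.
  lra.
rewrite normrM mulrC ler_wpM2r // normrM.
have yb : `|y - b| <= r by rewrite distrC; lra.
apply: le_trans (_ : e / r * r <= e); last by rewrite divfK // gt_eqF.
by apply: ler_pM.
Qed.

(** Integrate P along the horizontal line through the centre, then Q along the
    vertical line. *)
Lemma local_primitive : exists h : R * R -> R, forall z, ball (a, b) (r / 2) z ->
  partial_x h z (P z) /\ partial_y h z (Q z).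
Proof.
have rpos := r0; have half (c t : R) : `|c - t| < r / 2 -> `|c - t| < r.
  by move=> ht; apply: lt_le_trans ht _; lra.
have bb : `|b - b| < r by rewrite subrr normr0.
have [|U HU] := @antiderivative R (fun t => P (t, b)) a r r0.
  by move=> t at_; apply: continuous_slice_x; apply: cP; apply/ball_coord.
have /choice[W HW] x : exists W : R -> R, `|a - x| < r ->
    forall y, `|b - y| < r / 2 -> is_derive y (1 : R) W (Q (x, y)).
  have [ax|nax] := boolP (`|a - x| < r); last by exists (fun=> 0).
  have [|W HW] := @antiderivative R (fun t => Q (x, t)) b r r0.
    by move=> t bt; apply: continuous_slice_y; apply: cQ; apply/ball_coord.
  by exists W.
pose V x y := W x y - W x b.
have VQ x y : `|a - x| < r -> `|b - y| < r / 2 ->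
    is_derive y (1 : R) (V x) (Q (x, y)).
  move=> ax by_; rewrite -[Q _]subr0; apply: is_deriveB; exact: HW.
have VP := @differentiate_under_integral V (fun x _ => subrr _) VQ.
exists (fun z => U z.1 + V z.1 z.2) => -[x y] /ball_coord[/= ax by_].
split.
  apply/partial_xE => /=.
  rewrite (_ : P (x, y) = P (x, b) + (P (x, y) - P (x, b))); last by lra.
  by apply: is_deriveD; [exact: HU | apply: VP => //; exact: half].
apply/partial_yE => /=; rewrite -[Q _]add0r.
by apply: is_deriveD; apply: VQ => //; exact: half.
Qed.

End LocalPrimitive.

(** * Functions of class C^k and the Poincare lemma *)

Section ClassC.
Variables (R : realType) (Omega : set (R * R)).
Hypothesis openO : open Omega.
Implicit Types (u v P Q : R * R -> R) (p q : R * R).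

Lemma near_open p (A : R * R -> Prop) :
  Omega p -> (forall q, Omega q -> A q) -> \forall q \near p, A q.
Proof. by move=> Op OA; apply: filterS OA _; apply: open_nbhs_nbhs. Qed.

Lemma ball_in_open p : Omega p -> exists2 r : R, 0 < r & ball p r `<=` Omega.
Proof.
move=> Op; have /nbhs_ballP[r r0 Hr] : nbhs p Omega by apply: open_nbhs_nbhs.
by exists r.
Qed.

Lemma continuous_eq_on u v p : Omega p -> (forall q, Omega q -> u q = v q) ->
  {for p, continuous u} -> {for p, continuous v}.
Proof.
move=> Op uv /continuousP_eps cu; apply/continuousP_eps => e e0.
have [r r0 Hr] := cu e e0; have [s s0 Hs] := ball_in_open Op.
exists (Num.min r s); first by rewrite lt_min r0.
move=> q hq; rewrite -!uv //.
  by apply: Hr; apply: ball_shrink hq; rewrite ge_min lexx.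
by apply: Hs; apply: ball_shrink hq; rewrite ge_min lexx orbT.
Qed.

Lemma class_C_eq_on k u v : (forall q, Omega q -> u q = v q) ->
  class_C k Omega u -> class_C k Omega v.
Proof.
elim: k u v => [|k IH] u v uv [cu Du].
  by split => // p Op; apply: continuous_eq_on (cu p Op).
case: Du => Du [Cx Cy].
have near_uv p : Omega p -> \forall q \near p, u q = v q.
  by move=> Op; exact: near_open.
split; first by move=> p Op; apply: continuous_eq_on (cu p Op).
split.
  by move=> p Op; have [ux uy] := Du p Op; split;
    apply: (near_eq_derivable (near_uv p Op)).
split; [apply: IH Cx | apply: IH Cy] => p Op;
  exact: near_eq_derive (near_uv p Op).
Qed.

Lemma class_C1_elim u : class_C 1 Omega u -> forall p, Omega p ->
  [/\ {for p, continuous u}, partial_x u p (dx u p), partial_y u p (dy u p),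
      {for p, continuous (dx u)} & {for p, continuous (dy u)}].
Proof.
move=> [cu [Du [[cx _] [cy _]]]] p Op; have [ux uy] := Du p Op.
by split; [exact: cu | exact: DeriveDef | exact: DeriveDef | exact: cx | exact: cy].
Qed.

Lemma class_C2_elim u : class_C 2 Omega u ->
  [/\ class_C 1 Omega u, class_C 1 Omega (dx u) & class_C 1 Omega (dy u)].
Proof.
move=> [cu [Du [Cx Cy]]].
have C0x : class_C 0 Omega (dx u) by split => //; case: Cx.
have C0y : class_C 0 Omega (dy u) by split => //; case: Cy.
exact: (And3 (conj cu (conj Du (conj C0x C0y))) Cx Cy).
Qed.

Lemma dx_val u p d : partial_x u p d -> dx u p = d. Proof. by case. Qed.
Lemma dy_val u p d : partial_y u p d -> dy u p = d. Proof. by case. Qed.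

(** Continuity of u itself follows from that of its partial derivatives. *)
Lemma class_CS_intro k u P Q :
  (forall p, Omega p -> partial_x u p (P p) /\ partial_y u p (Q p)) ->
  class_C k Omega P -> class_C k Omega Q -> class_C k.+1 Omega u.
Proof.
move=> Du CP CQ; split.
  move=> p Op; have [r r0 Hr] := ball_in_open Op.
  have cP : {for p, continuous P} by case: k CP {CQ} => [|k] [cP _]; exact: cP.
  have cQ : {for p, continuous Q} by case: k CQ {CP} => [|k] [cQ _]; exact: cQ.
  by apply: (continuous_of_partials r0 _ cP cQ) => q /Hr /Du.
split; first by move=> p /Du [[? _] [? _]].
split; [apply: class_C_eq_on CP | apply: class_C_eq_on CQ] => q /Du [ux uy].
- by rewrite (dx_val ux).
- by rewrite (dy_val uy).
Qed.

Lemma class_C1_intro u P Q :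
  (forall p, Omega p -> [/\ partial_x u p (P p), partial_y u p (Q p),
     {for p, continuous P} & {for p, continuous Q}]) -> class_C 1 Omega u.
Proof.
move=> H; apply: (@class_CS_intro 0 u P Q); first by move=> p /H [].
  by split => // p /H [].
by split => // p /H [].
Qed.

Lemma class_C1_cst (c : R) : class_C 1 Omega (fun=> c).
Proof.
apply: (@class_C1_intro _ (fun=> 0) (fun=> 0)) => p _.
by split; [exact: is_derive_cst | exact: is_derive_cst | exact: cvg_cst | exact: cvg_cst].
Qed.

Lemma partial_x_fst p : partial_x fst p 1.
Proof. by case: p => x y; apply/partial_xE; exact: is_derive_id. Qed.
Lemma partial_y_fst p : partial_y fst p 0.
Proof. by case: p => x y; apply/partial_yE; exact: is_derive_cst. Qed.
Lemma partial_x_snd p : partial_x snd p 0.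
Proof. by case: p => x y; apply/partial_xE; exact: is_derive_cst. Qed.
Lemma partial_y_snd p : partial_y snd p 1.
Proof. by case: p => x y; apply/partial_yE; exact: is_derive_id. Qed.

Lemma class_C1_fst : class_C 1 Omega fst.
Proof.
apply: (@class_C1_intro _ (fun=> 1) (fun=> 0)) => p _.
by split; [exact: partial_x_fst | exact: partial_y_fst | exact: cvg_cst | exact: cvg_cst].
Qed.

Lemma class_C1_snd : class_C 1 Omega snd.
Proof.
apply: (@class_C1_intro _ (fun=> 0) (fun=> 1)) => p _.
by split; [exact: partial_x_snd | exact: partial_y_snd | exact: cvg_cst | exact: cvg_cst].
Qed.

Lemma class_C1_D u v : class_C 1 Omega u -> class_C 1 Omega v ->
  class_C 1 Omega (fun q => u q + v q).
Proof.
move=> /class_C1_elim Hu /class_C1_elim Hv.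
apply: (@class_C1_intro _ (fun q => dx u q + dx v q) (fun q => dy u q + dy v q)) => p Op.
have [cu ux uy cux cuy] := Hu p Op; have [cv vx vy cvx cvy] := Hv p Op.
by split; [exact: is_deriveD | exact: is_deriveD | exact: cvgD | exact: cvgD].
Qed.

Lemma class_C1_N u : class_C 1 Omega u -> class_C 1 Omega (fun q => - u q).
Proof.
move=> /class_C1_elim Hu.
apply: (@class_C1_intro _ (fun q => - dx u q) (fun q => - dy u q)) => p Op.
have [cu ux uy cux cuy] := Hu p Op.
by split; [exact: is_deriveN | exact: is_deriveN | exact: cvgN | exact: cvgN].
Qed.

Lemma class_C1_M u v : class_C 1 Omega u -> class_C 1 Omega v ->
  class_C 1 Omega (fun q => u q * v q).
Proof.
move=> /class_C1_elim Hu /class_C1_elim Hv.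
apply: (@class_C1_intro _ (fun q => u q * dx v q + v q * dx u q)
   (fun q => u q * dy v q + v q * dy u q)) => p Op.
have [cu ux uy cux cuy] := Hu p Op; have [cv vx vy cvx cvy] := Hv p Op.
split; [exact: is_deriveM | exact: is_deriveM | |]; by apply: cvgD; apply: cvgM.
Qed.

Lemma class_C1_sqr u : class_C 1 Omega u -> class_C 1 Omega (fun q => u q ^+ 2).
Proof.
rewrite (_ : (fun q => u q ^+ 2) = fun q => u q * u q).
  by move=> Cu; exact: class_C1_M.
by apply/funext => q; rewrite expr2.
Qed.

Lemma partial_x_comp (phi : R -> R) (d' : R) u p d :
  is_derive (u p) (1 : R) phi d' -> partial_x u p d ->
  partial_x (fun q => phi (u q)) p (d' * d).
Proof. by case: p => x y D /partial_xE Du; apply/partial_xE; exact: is_derive1_comp. Qed.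

Lemma partial_y_comp (phi : R -> R) (d' : R) u p d :
  is_derive (u p) (1 : R) phi d' -> partial_y u p d ->
  partial_y (fun q => phi (u q)) p (d' * d).
Proof. by case: p => x y D /partial_yE Du; apply/partial_yE; exact: is_derive1_comp. Qed.

Lemma class_C1_comp (phi phi' : R -> R) u :
  (forall p, Omega p -> is_derive (u p) (1 : R) phi (phi' (u p)) /\
     {for u p, continuous phi'}) ->
  class_C 1 Omega u -> class_C 1 Omega (fun q => phi (u q)).
Proof.
move=> Hphi /class_C1_elim Hu.
apply: (@class_C1_intro _ (fun q => phi' (u q) * dx u q)
  (fun q => phi' (u q) * dy u q)) => p Op.
have [cu ux uy cux cuy] := Hu p Op; have [D c'] := Hphi p Op.
have cc : {for p, continuous (phi' \o u)} by exact: continuous_comp.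
split; [exact: partial_x_comp | exact: partial_y_comp | |]; by apply: cvgM.
Qed.

Lemma class_C1_V u : (forall p, Omega p -> u p != 0) -> class_C 1 Omega u ->
  class_C 1 Omega (fun q => (u q)^-1).
Proof.
move=> u0; apply: (@class_C1_comp (fun x => x^-1) (fun x => - x ^- 2)) => p Op.
have up0 := u0 p Op; split.
  rewrite -[- _]mulr1; apply: (@is_deriveV R id (u p) 1 1) => //.
apply: cvgN; apply: cvgV; first by rewrite expf_neq0.
exact: exprn_continuous.
Qed.

Lemma class_C1_sqrt u : (forall p, Omega p -> 0 < u p) -> class_C 1 Omega u ->
  class_C 1 Omega (fun q => Num.sqrt (u q)).
Proof.
move=> u0; apply: (@class_C1_comp Num.sqrt (fun x => (2 * Num.sqrt x)^-1)) => p Op.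
have up0 := u0 p Op; split; first exact: is_derive1_sqrt.
apply: cvgV; first by rewrite mulf_neq0 // gt_eqF // sqrtr_gt0.
by apply: cvgM; [exact: cvg_cst | exact: sqrt_continuous].
Qed.

Lemma mixed_partials_C2 u p : class_C 2 Omega u -> Omega p ->
  dy (dx u) p = dx (dy u) p.
Proof.
move=> /class_C2_elim[/class_C1_elim C1 /class_C1_elim Cx /class_C1_elim Cy] Op.
have [r r0 Hr] := ball_in_open Op.
have [_ _ _ _ c1] := Cx p Op; have [_ _ _ c2 _] := Cy p Op.
have Dxy q : ball p r q -> partial_x u q (dx u q) /\ partial_y (dx u) q (dy (dx u) q).
  by move=> /Hr Oq; have [_ ux _ _ _] := C1 q Oq; have [_ _ uxy _ _] := Cx q Oq.
have Dyx q : ball p r q -> partial_y u q (dy u q) /\ partial_x (dy u) q (dx (dy u) q).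
  by move=> /Hr Oq; have [_ _ uy _ _] := C1 q Oq; have [_ uyx _ _ _] := Cy q Oq.
exact: (mixed_partials_eq r0 Dxy Dyx c1 c2).
Qed.

(** The set where v - u keeps a given value is open and closed in Omega. *)
Lemma eq_partials_constant u v : Omega !=set0 -> connected Omega ->
  class_C 1 Omega u -> class_C 1 Omega v ->
  (forall p, Omega p -> dx u p = dx v p /\ dy u p = dy v p) ->
  eq_up_to_constant Omega u v.
Proof.
move=> [p0 Op0] connO /class_C1_elim Cu /class_C1_elim Cv uv.
exists (v p0 - u p0) => p Op.
suff : v p - u p = v p0 - u p0 by lra.
move: p Op; apply: (connected_ind connO (S := [set p | v p - u p = v p0 - u p0])).
  by exists p0.
move=> p Op; have [r r0 Hr] := ball_in_open Op.
exists (interior (ball p r)).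
  by split; [exact: open_interior | exact: (nbhsx_ballx p r r0)].
move=> q Oq /nbhs_singleton pq /=.
suff : u p - u q = v p - v q by move=> ?; split; lra.
have pp : ball p r p by apply: ballxx.
apply: (@primitives_differ_by_constant R u v (dx u) (dy u) p p r r) => // z /Hr Oz.
  by have [] := Cu z Oz.
by have [-> ->] := uv z Oz; have [] := Cv z Oz.
Qed.

(** Local primitives on balls satisfy the hypotheses of [monodromy], and the
    global function obtained differs from each of them by a constant. *)
Theorem poincare_lemma P Q : simply_connected_domain Omega ->
  class_C 1 Omega P -> class_C 1 Omega Q ->
  (forall p, Omega p -> dy P p = dx Q p) ->
  exists u, class_C 2 Omega u /\
    forall p, Omega p -> dx u p = P p /\ dy u p = Q p.
Proof.
move=> sc CP CQ closed_PQ.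
have /class_C1_elim HP := CP; have /class_C1_elim HQ := CQ.
have /choice[rh Hrh] i : exists rh : R * (R * R -> R), Omega i ->
    [/\ 0 < rh.1, ball i rh.1 `<=` Omega &
      forall z, ball i rh.1 z -> partial_x rh.2 z (P z) /\ partial_y rh.2 z (Q z)].
  have [Oi|nOi] := pselect (Omega i); last by exists (0, P).
  have [r r0 Hr] := ball_in_open Oi.
  case: i Oi Hr => a b Oi Hr.
  have [|||||h Hh] := @local_primitive R P Q (dy P) a b r r0.
  - by move=> z /Hr /HP [].
  - by move=> z /Hr /HQ [].
  - by move=> z /Hr /HP [].
  - by move=> z /Hr /HP [].
  - by move=> z /Hr Oz; rewrite closed_PQ //; have [] := HQ z Oz.
  exists (r / 2, h) => _ /=; split => //; first by lra.
  by move=> z hz; apply: Hr; apply: ball_shrink hz; lra.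
have [i Oi|i j p q Oi Oj ip jp iq jq| |i Oi|g Hg] :=
    @monodromy R Omega (fun i => (rh i).1) (fun i => (rh i).2).
- by have [] := Hrh i Oi.
- have [_ _ Hi] := Hrh i Oi; have [_ _ Hj] := Hrh j Oj.
  exact: (primitives_differ_by_constant Hi Hj).
- exact: sc.
- by have [] := Hrh i Oi.
have Dg p : Omega p -> partial_x g p (P p) /\ partial_y g p (Q p).
  move=> Op; have [r0 Hr Hh] := Hrh p Op.
  have pp : ball p (rh p).1 p by apply: ballxx.
  have near_g : \forall q \near p, (rh p).2 q + (g p - (rh p).2 p) = g q.
    apply: filterS (nbhsx_ballx p _ r0) => q pq.
    by have := Hg p q p Op pq pp; lra.
  have [hx hy] := Hh p pp.
  split; apply: (near_eq_is_derive near_g).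
    by rewrite -[P p]addr0; apply: is_deriveD.
  by rewrite -[Q p]addr0; apply: is_deriveD.
exists g; split; first exact: (class_CS_intro Dg).
by move=> p /Dg [gx gy]; split; [exact: dx_val | exact: dy_val].
Qed.

End ClassC.

(** * The twin relation *)

Section TwinRelation.
Variables (R : realType) (kappa : R) (Omega : set (R * R)).
Hypothesis openO : open Omega.
Hypothesis deltaO : Omega `<=` Mkappa kappa.
Implicit Types (f g A B : R * R -> R) (p : R * R).

Let delta_gt0 p : Omega p -> 0 < delta kappa p. Proof. exact: deltaO. Qed.

Let delta_neq0 p : Omega p -> delta kappa p != 0.
Proof. by move=> /delta_gt0 d0; rewrite gt_eqF. Qed.

Lemma class_C1_delta : class_C 1 Omega (delta kappa).
Proof.
apply: (class_C1_D openO (class_C1_cst openO 1)).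
apply: (class_C1_M openO (class_C1_cst openO (kappa / 4))).
apply: (class_C1_D openO); apply: (class_C1_sqr openO).
  exact: class_C1_fst.
exact: class_C1_snd.
Qed.

Lemma class_C1_fst_delta : class_C 1 Omega (fun q => q.1 / delta kappa q).
Proof.
apply: (class_C1_M openO (class_C1_fst openO)).
exact: (class_C1_V openO delta_neq0 class_C1_delta).
Qed.

Lemma class_C1_snd_delta : class_C 1 Omega (fun q => q.2 / delta kappa q).
Proof.
apply: (class_C1_M openO (class_C1_snd openO)).
exact: (class_C1_V openO delta_neq0 class_C1_delta).
Qed.

(** The numerator is [2 delta - kappa / 2 (x ^ 2 + y ^ 2)], and
    [delta - 1 = kappa / 4 (x ^ 2 + y ^ 2)] reduces it to 2. *)
Lemma divergence_position_delta p : Omega p ->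
  dx (fun q => q.1 / delta kappa q) p + dy (fun q => q.2 / delta kappa q) p =
  2 / delta kappa p ^+ 2.
Proof.
case: p => x y Op; have d0 := delta_neq0 Op.
have Dquad (t c : R) : is_derive t (1 : R)
    (fun s => 1 + kappa / 4 * (s ^+ 2 + c)) (kappa / 4 * (2 * t)).
  have Dsq : is_derive t (1 : R) (fun s => s * s) (t * 1 + t * 1).
    exact: (is_deriveM (is_derive_id t (1 : R)) (is_derive_id t (1 : R))).
  have D := is_deriveD (is_derive_cst (1 : R) t (1 : R))
    (is_deriveZ (kappa / 4) (is_deriveD Dsq (is_derive_cst (c : R) t (1 : R)))).
  rewrite (_ : kappa / 4 * (2 * t) = 0 + kappa / 4 * (t * 1 + t * 1 + 0)); last by ring.
  exact: D.
have Ddx : partial_x (delta kappa) (x, y) (kappa / 4 * (2 * x)).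
  by apply/partial_xE; exact: (Dquad x (y ^+ 2)).
have Ddy : partial_y (delta kappa) (x, y) (kappa / 4 * (2 * y)).
  apply/partial_yE.
  rewrite (_ : (fun t => _) = (fun s => 1 + kappa / 4 * (s ^+ 2 + x ^+ 2))).
    exact: (Dquad y (x ^+ 2)).
  by apply/funext => t; rewrite /delta /= addrC (addrC (x ^+ 2)) addrC.
have DV (u : R) : u != 0 -> is_derive u (1 : R) (fun v => v^-1) (- u ^- 2).
  by move=> u0; rewrite -[- _]mulr1; apply: (@is_deriveV R id u 1 1).
have := is_deriveM (partial_x_fst (x, y)) (partial_x_comp (DV _ d0) Ddx).
move=> /dx_val ->.
have := is_deriveM (partial_y_snd (x, y)) (partial_y_comp (DV _ d0) Ddy).
move=> /dy_val ->.
rewrite /GRing.scale /=.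
have : delta kappa (x, y) = 1 + kappa / 4 * (x ^+ 2 + y ^+ 2) by [].
move: (delta kappa (x, y)) d0 => d d0 dE.
apply: (mulIf (expf_neq0 2 d0)); rewrite divfK ?expf_neq0 //.
rewrite (_ : _ * d ^+ 2 = 2 * d - 2 * (kappa / 4 * (x ^+ 2 + y ^+ 2))); last by field.
by rewrite dE; ring.
Qed.

(** An equation of constant mean curvature for (A, B) is the closedness of
    [(- B + T y / delta, A - T x / delta)]. *)
Lemma potential A B T : simply_connected_domain Omega ->
  class_C 1 Omega A -> class_C 1 Omega B ->
  (forall p, Omega p -> dx A p + dy B p = 2 * T / delta kappa p ^+ 2) ->
  exists u, class_C 2 Omega u /\ forall p, Omega p ->
    talpha kappa T u p = - B p /\ tbeta kappa T u p = A p.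
Proof.
move=> sc CA CB divAB.
have Cx := class_C1_fst_delta; have Cy := class_C1_snd_delta.
have /class_C1_elim Ex := Cx; have /class_C1_elim Ey := Cy.
have /class_C1_elim EA := CA; have /class_C1_elim EB := CB.
have CT := class_C1_cst openO T.
pose P q := - B q + T * (q.2 / delta kappa q).
pose Q q := A q + - (T * (q.1 / delta kappa q)).
have CP : class_C 1 Omega P.
  exact: (class_C1_D openO (class_C1_N openO CB) (class_C1_M openO CT Cy)).
have CQ : class_C 1 Omega Q.
  exact: (class_C1_D openO CA (class_C1_N openO (class_C1_M openO CT Cx))).
have [p Op|u [Cu Du]] := @poincare_lemma R Omega openO P Q sc CP CQ.
  have [_ _ By _ _] := EB p Op; have [_ Ax _ _ _] := EA p Op.
  have [_ xx _ _ _] := Ex p Op; have [_ _ yy _ _] := Ey p Op.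
  rewrite (dy_val (is_deriveD (is_deriveN By) (is_deriveZ T yy))).
  rewrite (dx_val (is_deriveD Ax (is_deriveN (is_deriveZ T xx)))).
  have := divAB p Op; have := divergence_position_delta Op.
  rewrite /GRing.scale /= -mulrA => E1 E2.
  have : T * (2 / delta kappa p ^+ 2) = 2 * (T / delta kappa p ^+ 2) by ring.
  rewrite -E2 -E1; lra.
exists u; split => // p Op; have [ux uy] := Du p Op.
by rewrite /talpha /tbeta ux uy /P /Q; split; lra.
Qed.

Lemma class_C1_alpha T u : class_C 2 Omega u -> class_C 1 Omega (alpha kappa T u).
Proof.
move=> /class_C2_elim[_ Cx _]; apply: (class_C1_D openO Cx).
exact: (class_C1_M openO (class_C1_cst openO T) class_C1_snd_delta).
Qed.

Lemma class_C1_beta T u : class_C 2 Omega u -> class_C 1 Omega (beta kappa T u).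
Proof.
move=> /class_C2_elim[_ _ Cy]; apply: (class_C1_D openO Cy (class_C1_N openO _)).
exact: (class_C1_M openO (class_C1_cst openO T) class_C1_fst_delta).
Qed.

(** The second derivatives of u cancel. *)
Lemma curl_alpha_beta T u p : class_C 2 Omega u -> Omega p ->
  dy (alpha kappa T u) p - dx (beta kappa T u) p = 2 * T / delta kappa p ^+ 2.
Proof.
move=> Cu Op; have [_ /class_C1_elim Cx /class_C1_elim Cy] := class_C2_elim Cu.
have [_ xx _ _ _] := class_C1_elim class_C1_fst_delta Op.
have [_ _ yy _ _] := class_C1_elim class_C1_snd_delta Op.
have [_ _ uxy _ _] := Cx p Op; have [_ uyx _ _ _] := Cy p Op.
rewrite (dy_val (is_deriveD uxy (is_deriveZ T yy))).
rewrite (dx_val (is_deriveD uyx (is_deriveN (is_deriveZ T xx)))).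
rewrite (mixed_partials_C2 openO Cu Op) /GRing.scale /=.
have := divergence_position_delta Op; rewrite -mulrA => E1.
have : T * (2 / delta kappa p ^+ 2) = 2 * (T / delta kappa p ^+ 2) by ring.
rewrite -E1; lra.
Qed.

(** By this change of parameter the lemmas on alpha and beta apply to g. *)
Lemma talphaE T : talpha kappa T = alpha kappa (- T).
Proof. by apply/funext => u; apply/funext => p; rewrite /talpha /alpha mulNr. Qed.

Lemma tbetaE T : tbeta kappa T = beta kappa (- T).
Proof. by apply/funext => u; apply/funext => p; rewrite /tbeta /beta mulNr opprK. Qed.

Variables (tau H : R).

Lemma omega_sq f p : omega kappa tau f p ^+ 2 =
  1 + delta kappa p ^+ 2 * (alpha kappa tau f p ^+ 2 + beta kappa tau f p ^+ 2).
Proof.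
rewrite /omega sqr_sqrtr // addr_ge0 // mulr_ge0 ?sqr_ge0 //.
by rewrite addr_ge0 ?sqr_ge0.
Qed.

Lemma omega_gt0 f p : 0 < omega kappa tau f p.
Proof.
rewrite sqrtr_gt0 ltr_pwDl //.
by rewrite mulr_ge0 ?sqr_ge0 // addr_ge0 ?sqr_ge0.
Qed.

(** With [w = omega], [1 - delta ^ 2 (a ^ 2 + b ^ 2) / w ^ 2 =
    (w ^ 2 - (w ^ 2 - 1)) / w ^ 2 = 1 / w ^ 2]. *)
Lemma tomega_eq_inv f g p :
  talpha kappa H g p = - (beta kappa tau f p / omega kappa tau f p) ->
  tbeta kappa H g p = alpha kappa tau f p / omega kappa tau f p ->
  0 < 1 - delta kappa p ^+ 2 * (talpha kappa H g p ^+ 2 + tbeta kappa H g p ^+ 2) /\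
  tomega kappa H g p = (omega kappa tau f p)^-1.
Proof.
move=> ta tb; have w0 := omega_gt0 f p.
have wn0 : omega kappa tau f p != 0 by rewrite gt_eqF.
have E : 1 - delta kappa p ^+ 2 * (talpha kappa H g p ^+ 2 + tbeta kappa H g p ^+ 2) =
   (omega kappa tau f p)^-1 ^+ 2.
  apply: (mulIf (expf_neq0 2 wn0)); rewrite -exprMn mulVf // expr1n.
  have := omega_sq f p; rewrite ta tb; move: (omega _ _ _ _) wn0 => w wn0 wE.
  set a := alpha _ _ _ _ in wE *; set b := beta _ _ _ _ in wE *.
  rewrite mulrBl mul1r.
  rewrite (_ : _ * w ^+ 2 = delta kappa p ^+ 2 * (a ^+ 2 + b ^+ 2)); last by field.
  by rewrite wE; ring.
rewrite E exprn_gt0 ?invr_gt0 //; split => //.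
by rewrite /tomega E sqrtr_sqr gtr0_norm ?invr_gt0.
Qed.

Lemma omega_eq_inv f g p :
  0 < 1 - delta kappa p ^+ 2 * (talpha kappa H g p ^+ 2 + tbeta kappa H g p ^+ 2) ->
  alpha kappa tau f p = tbeta kappa H g p / tomega kappa H g p ->
  beta kappa tau f p = - (talpha kappa H g p / tomega kappa H g p) ->
  omega kappa tau f p = (tomega kappa H g p)^-1.
Proof.
move=> sp a b; have w0 : 0 < tomega kappa H g p by rewrite sqrtr_gt0.
have wn0 : tomega kappa H g p != 0 by rewrite gt_eqF.
have wE : tomega kappa H g p ^+ 2 =
   1 - delta kappa p ^+ 2 * (talpha kappa H g p ^+ 2 + tbeta kappa H g p ^+ 2).
  by rewrite /tomega sqr_sqrtr // ltW.
have E : 1 + delta kappa p ^+ 2 * (alpha kappa tau f p ^+ 2 + beta kappa tau f p ^+ 2) =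
   (tomega kappa H g p)^-1 ^+ 2.
  apply: (mulIf (expf_neq0 2 wn0)); rewrite -exprMn mulVf // expr1n.
  rewrite a b; move: (tomega _ _ _ _) wn0 wE => w wn0 wE {w0 a b}.
  set ta := talpha _ _ _ _ in wE *; set tb := tbeta _ _ _ _ in wE *.
  rewrite mulrDl mul1r.
  rewrite (_ : _ * w ^+ 2 = delta kappa p ^+ 2 * (ta ^+ 2 + tb ^+ 2)); last by field.
  by rewrite wE; ring.
by rewrite /omega E sqrtr_sqr gtr0_norm ?invr_gt0.
Qed.

Lemma twin_firstP f g : twin_first kappa tau H Omega f g <->
  spacelike kappa H Omega g /\ twin_second kappa tau H Omega f g.
Proof.
split => [tw|[sp tw]].
  split => p Op; have [ta tb] := tw p Op; have [sp wE] := tomega_eq_inv ta tb => //.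
  have wn0 : omega kappa tau f p != 0 by rewrite gt_eqF // omega_gt0.
  by rewrite wE ta tb invrK mulNr !divfK // opprK.
move=> p Op; have [a b] := tw p Op; have wE := omega_eq_inv (sp p Op) a b.
have wn0 : tomega kappa H g p != 0 by rewrite gt_eqF // sqrtr_gt0 sp.
by rewrite wE a b invrK mulNr !divfK // opprK.
Qed.

Lemma class_C1_omega f : class_C 2 Omega f -> class_C 1 Omega (omega kappa tau f).
Proof.
move=> Cf; have Ca := class_C1_alpha tau Cf; have Cb := class_C1_beta tau Cf.
have Cd := class_C1_sqr openO class_C1_delta.
have Cab := class_C1_D openO (class_C1_sqr openO Ca) (class_C1_sqr openO Cb).
have C := class_C1_D openO (class_C1_cst openO 1) (class_C1_M openO Cd Cab).
apply: (class_C1_sqrt openO _ C) => p _.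
by have := omega_gt0 f p; rewrite sqrtr_gt0.
Qed.

Lemma class_C1_tomega g : class_C 2 Omega g -> spacelike kappa H Omega g ->
  class_C 1 Omega (tomega kappa H g).
Proof.
move=> Cg sp; have Ca := class_C1_alpha (- H) Cg; have Cb := class_C1_beta (- H) Cg.
rewrite -talphaE in Ca; rewrite -tbetaE in Cb.
have Cd := class_C1_sqr openO class_C1_delta.
have Cab := class_C1_D openO (class_C1_sqr openO Ca) (class_C1_sqr openO Cb).
have C := class_C1_D openO (class_C1_cst openO 1)
  (class_C1_N openO (class_C1_M openO Cd Cab)).
exact: (class_C1_sqrt openO sp C).
Qed.

Lemma dx_eq_on u v p : Omega p -> (forall q, Omega q -> u q = v q) -> dx u p = dx v p.
Proof. by move=> Op uv; apply: near_eq_derive; exact: (near_open openO Op uv). Qed.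
Lemma dy_eq_on u v p : Omega p -> (forall q, Omega q -> u q = v q) -> dy u p = dy v p.
Proof. by move=> Op uv; apply: near_eq_derive; exact: (near_open openO Op uv). Qed.

Lemma dxN u p : class_C 1 Omega u -> Omega p -> dx (fun q => - u q) p = - dx u p.
Proof. by move=> /class_C1_elim Cu /Cu [_ ux _ _ _]; apply: dx_val; exact: is_deriveN. Qed.
Lemma dyN u p : class_C 1 Omega u -> Omega p -> dy (fun q => - u q) p = - dy u p.
Proof. by move=> /class_C1_elim Cu /Cu [_ _ uy _ _]; apply: dy_val; exact: is_deriveN. Qed.

(** The field of the equation for g is (- beta, alpha), up to which the equation
    is [curl_alpha_beta]. *)
Lemma twin_lorentzian f g : class_C 2 Omega f -> class_C 2 Omega g ->
  twin_first kappa tau H Omega f g -> lorentzian_solution kappa tau H Omega g.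
Proof.
move=> Cf Cg /twin_firstP[sp tw]; split => // p Op.
rewrite -(curl_alpha_beta tau Cf Op).
have Eb q : Omega q -> talpha kappa H g q / tomega kappa H g q = - beta kappa tau f q.
  by move=> /tw [_ ->]; rewrite opprK.
have Ea q : Omega q -> tbeta kappa H g q / tomega kappa H g q = alpha kappa tau f q.
  by move=> /tw [-> _].
rewrite (dx_eq_on Op Eb) (dy_eq_on Op Ea) dxN //; first by rewrite addrC.
exact: class_C1_beta.
Qed.

(** The same argument, with the field (tbeta, - talpha) and parameter - H. *)
Lemma twin_riemannian f g : class_C 2 Omega f -> class_C 2 Omega g ->
  twin_first kappa tau H Omega f g -> riemannian_solution kappa tau H Omega f.
Proof.
move=> Cf Cg tw; split => // p Op.
have Eb q : Omega q -> beta kappa tau f q / omega kappa tau f q = - talpha kappa H g q.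
  by move=> /tw [-> _]; rewrite opprK.
have Ea q : Omega q -> alpha kappa tau f q / omega kappa tau f q = tbeta kappa H g q.
  by move=> /tw [_ ->].
rewrite (dx_eq_on Op Ea) (dy_eq_on Op Eb) talphaE tbetaE dyN //; last exact: class_C1_alpha.
have := curl_alpha_beta (- H) Cg Op; rewrite mulrN mulNr; lra.
Qed.

Lemma lorentzian_twin_exists f : simply_connected_domain Omega ->
  riemannian_solution kappa tau H Omega f ->
  exists2 g, class_C 2 Omega g & twin_first kappa tau H Omega f g.
Proof.
move=> sc [Cf Ef]; have Ca := class_C1_alpha tau Cf; have Cb := class_C1_beta tau Cf.
have CV : class_C 1 Omega (fun q => (omega kappa tau f q)^-1).
  apply: (class_C1_V openO _ (class_C1_omega Cf)) => p _.
  by rewrite gt_eqF // omega_gt0.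
have [p Op|g [Cg Dg]] := potential sc (class_C1_M openO Ca CV) (class_C1_M openO Cb CV) (T := H).
  exact/esym/Ef.
by exists g => // p /Dg [-> ->].
Qed.

(** The potential of the field opposite to that of the equation for g, whence the
    parameter - tau. *)
Lemma riemannian_twin_exists g : simply_connected_domain Omega ->
  lorentzian_solution kappa tau H Omega g ->
  exists2 f, class_C 2 Omega f & twin_first kappa tau H Omega f g.
Proof.
move=> sc [Cg sp Eg].
have Ca := class_C1_alpha (- H) Cg; have Cb := class_C1_beta (- H) Cg.
rewrite -talphaE in Ca; rewrite -tbetaE in Cb.
have CV : class_C 1 Omega (fun q => (tomega kappa H g q)^-1).
  apply: (class_C1_V openO _ (class_C1_tomega Cg sp)) => p Op.
  by rewrite gt_eqF // sqrtr_gt0 sp.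
have CA := class_C1_M openO Ca CV; have CB := class_C1_M openO Cb CV.
have [p Op|f [Cf Df]] := potential sc (class_C1_N openO CA) (class_C1_N openO CB) (T := - tau).
  rewrite dxN // dyN //; have := Eg p Op; rewrite mulrN mulNr; lra.
exists f => //; apply/twin_firstP; split => // p Op; have [] := Df p Op.
by rewrite (talphaE (- tau)) (tbetaE (- tau)) !opprK => -> ->.
Qed.

Lemma twin_first_unique f g g' : connected Omega -> Omega !=set0 ->
  class_C 2 Omega g -> class_C 2 Omega g' ->
  twin_first kappa tau H Omega f g -> twin_first kappa tau H Omega f g' ->
  eq_up_to_constant Omega g g'.
Proof.
move=> cO nO /class_C2_elim[Cg _ _] /class_C2_elim[Cg' _ _] tw tw'.
apply: eq_partials_constant => // p Op.
have [] := tw p Op; have [<- <-] := tw' p Op.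
by rewrite /talpha /tbeta => ? ?; split; lra.
Qed.

Lemma twin_second_unique f f' g : connected Omega -> Omega !=set0 ->
  class_C 2 Omega f -> class_C 2 Omega f' ->
  twin_second kappa tau H Omega f g -> twin_second kappa tau H Omega f' g ->
  eq_up_to_constant Omega f f'.
Proof.
move=> cO nO /class_C2_elim[Cf _ _] /class_C2_elim[Cf' _ _] tw tw'.
apply: eq_partials_constant => // p Op.
have [] := tw p Op; have [<- <-] := tw' p Op.
by rewrite /alpha /beta => ? ?; split; lra.
Qed.

Lemma eq_up_to_constant_partials u v p : Omega p -> class_C 1 Omega u ->
  eq_up_to_constant Omega u v -> dx v p = dx u p /\ dy v p = dy u p.
Proof.
move=> Op /class_C1_elim Cu [c uv].
have vE q : Omega q -> v q = u q + c by exact: uv.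
rewrite (dx_eq_on Op vE) (dy_eq_on Op vE).
have [_ ux uy _ _] := Cu p Op.
by split; [apply: dx_val | apply: dy_val]; rewrite -[X in _ _ _ X]addr0; apply: is_deriveD.
Qed.

Lemma twin_first_translate f f' g g' : class_C 1 Omega f -> class_C 1 Omega g ->
  eq_up_to_constant Omega f f' -> eq_up_to_constant Omega g g' ->
  twin_first kappa tau H Omega f g -> twin_first kappa tau H Omega f' g'.
Proof.
move=> Cf Cg ff' gg' tw p Op.
have [fx fy] := eq_up_to_constant_partials Op Cf ff'.
have [gx gy] := eq_up_to_constant_partials Op Cg gg'.
by have := tw p Op; rewrite /talpha /tbeta /omega /alpha /beta fx fy gx gy.
Qed.

End TwinRelation.

Section Classes.
Variables (R : realType) (Omega : set (R * R)).
Implicit Types (f g h : R * R -> R) (S : set (R * R -> R)).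

Lemma eq_up_to_constant_refl f : eq_up_to_constant Omega f f.
Proof. by exists 0 => p _; rewrite addr0. Qed.

Lemma eq_up_to_constant_sym f g :
  eq_up_to_constant Omega f g -> eq_up_to_constant Omega g f.
Proof. by move=> [c E]; exists (- c) => p Op; rewrite E // addrK. Qed.

Lemma eq_up_to_constant_trans f g h : eq_up_to_constant Omega f g ->
  eq_up_to_constant Omega g h -> eq_up_to_constant Omega f h.
Proof.
by move=> [c E] [d E']; exists (c + d) => p Op; rewrite E' // E // addrA.
Qed.

Lemma class_mod_constants_refl S f : S f -> class_mod_constants Omega S f f.
Proof. by move=> Sf; split => //; exact: eq_up_to_constant_refl. Qed.

Lemma class_mod_constants_eq S f g : eq_up_to_constant Omega f g ->
  class_mod_constants Omega S f = class_mod_constants Omega S g.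
Proof.
move=> fg; apply/seteqP; split => h [Sh E]; split => //.
  exact: eq_up_to_constant_trans (eq_up_to_constant_sym fg) E.
exact: eq_up_to_constant_trans fg E.
Qed.

End Classes.

Theorem theorem1p8 (R : realType) (kappa tau H : R) (Omega : set (R * R))
    (hM : Omega `<=` Mkappa kappa) (hO : simply_connected_domain Omega) :
  let Sol1 := riemannian_solution kappa tau H Omega in
  let Sol2 := lorentzian_solution kappa tau H Omega in
  let cl1 := class_mod_constants Omega Sol1 in
  let cl2 := class_mod_constants Omega Sol2 in
  (* (a), (b): the twin correspondence *)
  (exists Phi : set (R * R -> R) -> set (R * R -> R),
     [/\ set_bij (quotient_mod_constants Omega Sol1)
                 (quotient_mod_constants Omega Sol2) Phi,
         (forall f g, Sol1 f -> class_C 2 Omega g ->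
            (Sol2 g /\ Phi (cl1 f) = cl2 g <->
             twin_first kappa tau H Omega f g)) &
         (forall f g, class_C 2 Omega f -> Sol2 g ->
            (Sol1 f /\ Phi (cl1 f) = cl2 g <->
             twin_second kappa tau H Omega f g))]) /\
  (* (b): the two forms of the twin relation are equivalent *)
  (forall f g, class_C 2 Omega f -> class_C 2 Omega g ->
     (twin_first kappa tau H Omega f g <->
      spacelike kappa H Omega g /\ twin_second kappa tau H Omega f g)) /\
  (* (c) *)
  (forall f g fhat, Sol1 f -> class_C 2 Omega g -> class_C 2 Omega fhat ->
     twin_first kappa tau H Omega f g ->
     twin_second kappa tau H Omega fhat g ->
     eq_up_to_constant Omega f fhat).
Proof.
move=> Sol1 Sol2 cl1 cl2.
have [[nO oO cO] _] := hO.
have C1 f : class_C 2 Omega f -> class_C 1 Omega f by move=> /class_C2_elim[].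
pose twin := twin_first kappa tau H Omega.
have twin_unique f f' g : class_C 2 Omega f -> class_C 2 Omega f' ->
    twin f g -> twin f' g -> eq_up_to_constant Omega f f'.
  move=> Cf Cf' /twin_firstP[_ tw] /twin_firstP[_ tw'].
  exact: twin_second_unique tw tw'.
(* The union of the classes of all twins of the members of a class. *)
pose Phi (F : set (R * R -> R)) : set (R * R -> R) :=
  [set g | Sol2 g /\ exists2 f, F f & twin f g].
have PhiE f g : Sol1 f -> Sol2 g -> twin f g -> Phi (cl1 f) = cl2 g.
  move=> [Cf Ef] Sg tw; have Cg : class_C 2 Omega g by case: Sg.
  apply/seteqP; split => h [Sh].
    move=> [f' [[Cf' _] ff'] tw']; split => //.
    apply: (twin_first_unique oO cO nO Cg _ tw); first by case: Sh.
    apply: (twin_first_translate oO _ _ _ _ tw') => //.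
    - exact: C1.
    - by apply: C1; case: Sh.
    - exact: eq_up_to_constant_sym.
    - exact: eq_up_to_constant_refl.
  move=> gh; split => //; exists f; first exact: class_mod_constants_refl.
  apply: (twin_first_translate oO _ _ _ gh tw); [exact: C1|exact: C1|].
  exact: eq_up_to_constant_refl.
have Phi_twin f g : Sol1 f -> Sol2 g -> Phi (cl1 f) = cl2 g -> twin f g.
  move=> [Cf Ef] Sg E; have : cl2 g g by exact: class_mod_constants_refl.
  rewrite -E => -[_ [f' [[Cf' _] ff'] tw]].
  apply: (twin_first_translate oO _ _ _ _ tw).
  - exact: C1.
  - by apply: C1; case: Sg.
  - exact: eq_up_to_constant_sym.
  - exact: eq_up_to_constant_refl.
split; last split.
- exists Phi; split.
  + split.
    * move=> _ [f Sf <-]; have [g Cg tw] := lorentzian_twin_exists oO hM hO Sf.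
      have Sg : Sol2 g by apply: (twin_lorentzian oO hM _ Cg tw); case: Sf.
      by exists g => //; rewrite (PhiE f g).
    * move=> F F'; rewrite !inE => -[f Sf <-] [f' Sf' <-].
      have [g Cg tw] := lorentzian_twin_exists oO hM hO Sf.
      have Sg : Sol2 g by apply: (twin_lorentzian oO hM _ Cg tw); case: Sf.
      rewrite (PhiE f g) // => /esym /(Phi_twin _ _ Sf' Sg) tw'.
      apply: class_mod_constants_eq; apply: twin_unique tw tw'; [by case: Sf | by case: Sf'].
    * move=> _ [g Sg <-]; have [f Cf tw] := riemannian_twin_exists oO hM hO Sg.
      have Sf : Sol1 f by apply: (twin_riemannian oO hM Cf _ tw); case: Sg.
      by exists (cl1 f); [exists f | exact: PhiE].
  + move=> f g Sf Cg; split; first by move=> [Sg]; exact: Phi_twin.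
    move=> tw; have Sg : Sol2 g by apply: (twin_lorentzian oO hM _ Cg tw); case: Sf.
    by split => //; exact: PhiE.
  + move=> f g Cf Sg; have [Cg sp _] := Sg; split.
      by move=> [Sf] /(Phi_twin _ _ Sf Sg) /twin_firstP[].
    move=> tw2; have tw : twin f g by apply/twin_firstP.
    have Sf : Sol1 f by exact: (twin_riemannian oO hM Cf Cg tw).
    by split => //; exact: PhiE.
- by move=> f g _ _; exact: twin_firstP.
- move=> f g fhat [Cf _] Cg Cfhat /twin_firstP[_ tw] tw'.
  exact: twin_second_unique tw tw'.
Qed.
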